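(* Consider AugmentedGreedy on the undirected coupled multiplicative $\alpha$-spanner problem. (i) For $\alpha=2k-1$, $k\in\mathbb{N}_{\ge1}$, it yields $\alpha$-spanners of lightness (and thus weight ratio $w(H)/\mathrm{OPT}$) $\mathcal{O}(n/k)$ and size $\mathcal{O}(n^{1+1/k})$. (ii) In the geometric setting, these improve to lightness $\mathcal{O}(\log n)$ and size $\mathcal{O}(n)$, for all $\alpha>1$. (iii) For $\alpha\ge\log n$ and $\alpha\ge(\log n)^2$, the lightness is in $\mathcal{O}(\log n)$ and $\mathcal{O}(1)$, respectively. (iv) Violating the distance demands of $(2k-1)$-spanners, with $k$ as in (i), by a factor of $(1+\varepsilon)$, $\varepsilon>0$, it yields $(1+\varepsilon)(2k-1)$-spanners of lightness $\mathcal{O}\big(n^{1/k}\big(1+k/(\varepsilon^{1+1/k}\log k)\big)\big)$.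
   Context: Undirected coupled multiplicative $\alpha$-spanner problem: given a connected simple undirected graph $G=(V,E)$ with $n$ nodes and edge values $w(e)=\ell(e)>0$ (weight equals length for every edge), find a minimum-weight subgraph $H=(V,E')$, $E'\subseteq E$, with $d_H^\ell(u,v)\le\delta(u,v):=\alpha\cdot d_G^\ell(u,v)$ for all node pairs (such an $H$ is called a feasible spanner, or an $\alpha$-spanner), where $d^\ell$ is shortest-path distance w.r.t. $\ell$. It suffices to enforce the demands for the metric edges $M\subseteq E$, i.e. the edges $e=\{u,v\}$ with $d^\ell_{G-e}(u,v)>\ell(e)$; the algorithm is run with terminal pairs $K=M$. The size of $H$ is $|E'|$; its lightness is $w(E')/w(\mathit{MST}(G,w))$, where $w(E')=\sum_{e\in E'}w(e)$ and $\mathit{MST}(G,w)$ is a minimum-weight spanning tree of $G$; $w(H)=w(E')$, and $\mathrm{OPT}$ is the minimum weight of a feasible spanner. Geometric setting: $G$ is a complete graph with Euclidean lengths (values may then be real numbers). Greedy$(G,K,\ell,\delta)$: start with $H=(V,\emptyset)$; process the pairs $(u,v)\in K$ in non-decreasing order of $d_G^\ell(u,v)$; if $d_H^\ell(u,v)>\delta(u,v)$ for the current $H$, add to $H$ the shortest $uv$-path of $G$ w.r.t. $\ell$, where ties are broken consistently so that shortest paths are unique. Return $H$. AugmentedGreedy$(G,K,w,\ell,\delta)$: let $\mathcal W=\{w(e):e\in E\}$, $E[w']=\{e\in E:w(e)\le w'\}$, $G[w']=(V,E[w'])$. (1) Determine $\hat w=\min\{w'\in\mathcal W:G[w']\text{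 is a feasible spanner}\}$. (2) Set $\hat w\leftarrow\max\{\hat w,w(\mathit{MST}(G,w))\}$. (3) Return Greedy$(G[\hat w],K,\ell,\delta)$ (with $\delta$ unchanged, i.e. defined via distances in the original $G$).
   Formalization: In (i) lightness O(n/k) is stated for 2 ≤ k ≤ n (it is false at k = 1, and for k beyond a multiple of n) and the weight ratio for k ≤ n; in (iv) the lightness bound is stated for k ≥ 2, since log k = 0 at k = 1. *)

(* Defs.v *)
From HB Require Import structures.
From mathcomp Require Import all_boot all_order all_algebra.
From mathcomp Require Import all_classical all_reals all_analysis.
Set Implicit Arguments.
Unset Strict Implicit.
Unset Printing Implicit Defensive.
Import Order.TTheory GRing.Theory Num.Theory.
Local Open Scope ring_scope.

(* A simple undirected graph on V is its edge set F : {set {set V}} of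
   two-element subsets of V; a subgraph on the same nodes is a subset of F. *)
Section Graphs.
Variable V : finType.
Implicit Types (F T : {set {set V}}) (u v x : V) (p : seq V).

Definition complete_edges : {set {set V}} := [set e : {set V} | #|e| == 2].

Definition adj F : rel V := fun u v => [set u; v] \in F.

Definition connected_graph F : Prop := forall u v, connect (adj F) u v.

(* A simple cycle of size 2 only walks an edge back and forth. *)
Definition acyclic F : Prop := forall p, ucycle (adj F) p -> (size p <= 2)%N.

Definition spanning_tree F T : Prop :=
  [/\ T \subset F, connected_graph T & acyclic T].

(* The walk u :: p is given by its start u and its remaining nodes p. *)
Definition is_walk F u v p : Prop := path (adj F) u p /\ last u p = v.

Definition walk_edges u p : seq {set V} :=
  pairmap (fun x y => [set x; y]) u p.

End Graphs.

Section Spanners.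
Variables (R : realType) (V : finType).
Implicit Types (E F H K T : {set {set V}}) (w l : {set V} -> R) (u v : V).
Implicit Types (delta : V -> V -> \bar R) (sp : V -> V -> seq V).
Implicit Types (s : seq (V * V)).

Definition weight w F : R := \sum_(e in F) w e.

Definition walk_length l u (p : seq V) : R := \sum_(e <- walk_edges u p) l e.

(* Shortest-path distance in F; +oo when u and v are not connected. *)
Definition dist F l u v : \bar R :=
  ereal_inf [set (walk_length l u p)%:E | p in [set p | is_walk F u v p]]%classic.

Definition demand (alpha : R) E l u v : \bar R := (alpha%:E * dist E l u v)%E.

Definition feasible E l delta F : bool :=
  (F \subset E) && [forall u, forall v, (dist F l u v <= delta u v)%E].

(* The infima in mst_weight, opt and what1 range over finite sets, so they are
   minima (whenever there is something to minimize over). *)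
Definition mst_weight E w : R :=
  inf [set weight w T | T in [set T | spanning_tree E T]]%classic.

Definition lightness E w H : R := weight w H / mst_weight E w.

Definition opt E w l delta : R :=
  inf [set weight w F | F in [set F | feasible E l delta F]]%classic.

Definition metric_edges E l : {set {set V}} :=
  [set e in E | [forall u, forall v,
     (e == [set u; v]) ==> ((l e)%:E < dist (E :\ e) l u v)%E]].

(* sp is a consistent tie-breaking between shortest paths of F: it selects one
   shortest path per connected pair, independently of the direction in which
   the pair is read, and subpaths of selected paths are selected. *)
Definition consistent_shortest_paths F l sp : Prop :=
  forall u v, connect (adj F) u v ->
  [/\ is_walk F u v (sp u v),
      (walk_length l u (sp u v))%:E = dist F l u v,
      v :: sp v u = rev (u :: sp u v)
    & forall p q, sp u v = p ++ q ->
        sp u (last u p) = p /\ sp (last u p) v = q].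

(* s lists every unordered terminal pair once, in one of its orientations. *)
Definition terminal_order F K l s : Prop :=
  perm_eq [seq [set q.1; q.2] | q <- s] (enum K) /\
  sorted (fun q r => (dist F l q.1 q.2 <= dist F l r.1 r.2)%E) s.

Definition greedy_step l delta sp H (q : V * V) : {set {set V}} :=
  if (delta q.1 q.2 < dist H l q.1 q.2)%E
  then H :|: [set e in walk_edges q.1 (sp q.1 q.2)] else H.

(* H is a possible output on the graph F; the run is determined by the order
   among terminal pairs of equal distance and by the tie-breaking between
   shortest paths. *)
Definition greedy F K l delta H : Prop :=
  exists s sp, [/\ terminal_order F K l s, consistent_shortest_paths F l sp
    & H = foldl (greedy_step l delta sp) finset.set0 s].

Definition light_subgraph E w (c : R) : {set {set V}} := [set e in E | w e <= c].

Definition what1 E w l delta : R :=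
  inf [set w e | e in
        [set e | e \in E /\ feasible E l delta (light_subgraph E w (w e))]]%classic.

Definition what E w l delta : R :=
  Num.max (what1 E w l delta) (mst_weight E w).

Definition augmented_greedy E K w l delta H : Prop :=
  greedy (light_subgraph E w (what E w l delta)) K l delta H.

Definition spanner_instance E l : Prop :=
  [/\ E \subset complete_edges V, connected_graph E & forall e, e \in E -> 0 < l e].

Definition augmented_greedy_spanner (alpha : R) E l H : Prop :=
  augmented_greedy E (metric_edges E l) l l (demand alpha E l) H.

Definition is_spanner (alpha : R) E l H : bool := feasible E l (demand alpha E l) H.

Definition weight_ratio (alpha : R) E l H : R :=
  weight l H / opt E l l (demand alpha E l).

(* The norm of 'rV[R]_d in the library is the sup norm. *)
Definition euclidean_dist d (x y : 'rV[R]_d) : R :=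
  Num.sqrt (\sum_(i < d) (x ord0 i - y ord0 i) ^+ 2).

Definition geometric_instance d E l : Prop :=
  [/\ spanner_instance E l, E = complete_edges V
    & exists pt : V -> 'rV[R]_d,
        forall u v, l [set u; v] = euclidean_dist (pt u) (pt v)].

End Spanners.

(* Main.v *)
Require Import Defs.
From HB Require Import structures.
From mathcomp Require Import all_boot all_order all_algebra.
From mathcomp Require Import all_classical all_reals all_analysis.
From mathcomp Require Import ring lra zify.
Set Implicit Arguments.
Unset Strict Implicit.
Unset Printing Implicit Defensive.
Import Order.TTheory GRing.Theory Num.Theory.
Local Open Scope ring_scope.

(* Let H be the output, T a minimum spanning tree and W its weight. Every metric
   edge is at most W long, so the run is the ordinary greedy algorithm on the
   metric edges. Two features of H suffice for everything else: it is critical,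
   that is, deleting an edge e from H leaves no walk of length at most alpha l(e)
   between its ends; and the ends of every edge e of G are joined in H by a walk
   of length at most alpha l(e) all of whose edges are no longer than e. By the
   second one, H contains a minimum spanning tree T.

   A traversal of T places the nodes on a line of length 2 W in such a way that
   distances in T are at most distances on the line; this turns bounds on the
   weight of H into packing and counting arguments on the line.
   (i) The edges at one node have ends that are far apart on the line, which gives
   n/k; the size is the Moore bound, as H has no cycle of at most 2 k edges.
   (iv) Edges with lengths in [w, k w) are transported to a graph on intervals of
   length about eps w of the line, each edge together with its parallel shifts by
   up to its length. This graph still has no cycle of at most 2 k edges, so the
   Moore bound controls the total length of the edges; summing over the scales
   w = k^i W/n gives a geometric series of ratio k^(-1/k), hence the factor k/log k.
   (iii) follows from (iv) with k about (log n)/4.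
   (ii) In Euclidean space, two edges of about the same length and direction that
   start in the same short interval of the line cannot both lie in H, so each of
   the O(log n) scales contributes O(W); edges at the same node with about the
   same direction are excluded likewise, whatever their lengths. *)

(** * Walks of bounded length *)

Lemma eq_set2 (T : finType) (x y u v : T) : [set x; y] = [set u; v] ->
  (x = u /\ y = v) \/ (x = v /\ y = u).
Proof.
move=> xy.
have : x \in [set u; v] by rewrite -xy !inE eqxx.
have : y \in [set u; v] by rewrite -xy !inE eqxx orbT.
have : u \in [set x; y] by rewrite xy !inE eqxx.
have : v \in [set x; y] by rewrite xy !inE eqxx orbT.
by rewrite !inE; do 4 case/orP=> /eqP ?; subst; auto.
Qed.

Section Walks.
Variables (R : realType) (V : finType).
Implicit Types (F G H T : {set {set V}}) (l : {set V} -> R) (u v x y : V).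
Implicit Types (c : R) (p : seq V).

(** Bounded walks compose, reverse and restrict to subgraphs by real arithmetic alone; [dist_le]
    translates to and from distances in the extended reals. *)
Definition reach l F u v c : Prop :=
  exists2 p, is_walk F u v p & walk_length l u p <= c.

Definition nonneg_on l F : Prop := forall e, e \in F -> 0 <= l e.

Lemma walk_length_cons l u x p :
  walk_length l u (x :: p) = l [set u; x] + walk_length l x p.
Proof. by rewrite /walk_length /= big_cons. Qed.

Lemma walk_length_nil l u : walk_length l u [::] = 0.
Proof. by rewrite /walk_length big_nil. Qed.

Lemma walk_length_cat l u p q :
  walk_length l u (p ++ q) = walk_length l u p + walk_length l (last u p) q.
Proof.
elim: p u => [|x p IH] u /=; first by rewrite walk_length_nil add0r.
by rewrite !walk_length_cons IH addrA.
Qed.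

Lemma adjC F u v : adj F u v = adj F v u.
Proof. by rewrite /adj finset.setUC. Qed.

Lemma walk_length_ge0 l F u p :
  nonneg_on l F -> path (adj F) u p -> 0 <= walk_length l u p.
Proof.
move=> lF; elim: p u => [|x p IH] u /=; first by rewrite walk_length_nil.
by case/andP=> ux xp; rewrite walk_length_cons addr_ge0 ?IH ?lF.
Qed.

Lemma reach_refl l F u c : 0 <= c -> reach l F u u c.
Proof. by move=> c0; exists [::]; rewrite ?walk_length_nil. Qed.

Lemma reach_trans l F u v x c c' :
  reach l F u v c -> reach l F v x c' -> reach l F u x (c + c').
Proof.
move=> [p [pp <-] lp] [q [pq <-] lq]; exists (p ++ q).
  by split; rewrite ?cat_path ?pp ?last_cat.
by rewrite walk_length_cat lerD.
Qed.

Lemma reach_le l F u v c c' : c <= c' -> reach l F u v c -> reach l F u v c'.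
Proof. by move=> cc [p wp lp]; exists p => //; apply: le_trans lp cc. Qed.

Lemma reach_edge l F u v : [set u; v] \in F -> reach l F u v (l [set u; v]).
Proof.
move=> uv; exists [:: v]; first by split; rewrite //= /adj uv.
by rewrite walk_length_cons walk_length_nil addr0.
Qed.

Lemma reach_cons l F u x v c :
  [set u; x] \in F -> reach l F x v c -> reach l F u v (l [set u; x] + c).
Proof. by move=> ux; apply: reach_trans; apply: reach_edge. Qed.

Lemma reach_sym l F u v c : reach l F u v c -> reach l F v u c.
Proof.
move=> [p [pp <-]] lp; apply: reach_le lp _.
elim: p u pp => [|x p IH] u /=; first by rewrite walk_length_nil => _; apply: reach_refl.
case/andP=> ux /IH xp; rewrite walk_length_cons addrC.
apply: reach_trans xp _; rewrite finset.setUC; apply: reach_edge.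
by rewrite finset.setUC.
Qed.

Lemma reach_ge0 l F u v c : nonneg_on l F -> reach l F u v c -> 0 <= c.
Proof. by move=> lF [p [pp _]]; apply: le_trans; apply: walk_length_ge0 pp. Qed.

Lemma reach_rect l F (P : V -> V -> R -> Prop) :
  nonneg_on l F ->
  (forall u c, 0 <= c -> P u u c) ->
  (forall u x v c, [set u; x] \in F -> P x v c -> P u v (l [set u; x] + c)) ->
  (forall u v c c', c <= c' -> P u v c -> P u v c') ->
  forall u v c, reach l F u v c -> P u v c.
Proof.
move=> lF P0 PS Ple u v c [p [pp <-]] lp; apply: Ple lp _.
elim: p u pp => [|x p IH] u /=; first by rewrite walk_length_nil => _; apply: P0.
by case/andP=> ux /IH xp; rewrite walk_length_cons; apply: PS.
Qed.

(** With nonnegative lengths, no edge of a walk is longer than the whole walk, so only edges of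
    length at most [c] occur. *)
Lemma reach_sub_cheap l F G u v c : nonneg_on l F ->
  (forall e, e \in F -> l e <= c -> e \in G) -> reach l F u v c -> reach l G u v c.
Proof.
move=> lF FG [p [pp <-]] lp; exists p => //; split=> //.
elim: p u pp lp => [|x p IH] u //= /andP[ux pp]; rewrite walk_length_cons => lp.
apply/andP; split.
  apply: FG => //; apply: le_trans lp.
  by rewrite lerDl; apply: walk_length_ge0 pp.
by apply: IH => //; apply: le_trans lp; rewrite lerDr; apply: lF.
Qed.

Lemma reachS l F G u v c : F \subset G -> reach l F u v c -> reach l G u v c.
Proof.
move=> /fintype.subsetP FG [p [pp <-]] lp; exists p => //; split=> //.
by apply: sub_path pp => x y; apply: FG.
Qed.

Lemma reach_avoid l F e u v c : nonneg_on l F -> c < l e ->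
  reach l F u v c -> reach l (F :\ e) u v c.
Proof.
move=> lF ce; apply: reach_sub_cheap => // f fF fc.
by rewrite !inE fF andbT; apply: contraTneq fc => ->; rewrite -ltNge.
Qed.

Lemma reach_connect l F u v c : reach l F u v c -> connect (adj F) u v.
Proof. by case=> p [pp <-] _; apply/connectP; exists p. Qed.

Lemma connect_reach l F u v : connect (adj F) u v -> exists c, reach l F u v c.
Proof. by case/connectP=> p pp ->; exists (walk_length l u p), p. Qed.

Lemma connect_adjC F : connect_sym (adj F).
Proof. by apply: sym_connect_sym; move=> u v; apply: adjC. Qed.

(** A walk that crosses [xy] repeatedly can be shortened until it crosses at most once: crossings in
    the same direction merge into one, and opposite crossings cancel together with what lies between
    them. *)
Lemma reach_split l F x y u v c : nonneg_on l ([set x; y] |: F) ->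
  reach l ([set x; y] |: F) u v c ->
  reach l F u v c \/
  exists c1 c2, c1 + c2 + l [set x; y] <= c /\
    ((reach l F u x c1 /\ reach l F y v c2) \/
     (reach l F u y c1 /\ reach l F x v c2)).
Proof.
move=> lF; pose P u v c := reach l F u v c \/
  exists c1 c2, c1 + c2 + l [set x; y] <= c /\
    ((reach l F u x c1 /\ reach l F y v c2) \/
     (reach l F u y c1 /\ reach l F x v c2)).
have lF' : nonneg_on l F by move=> e eF; apply: lF; rewrite inE eF orbT.
apply: (@reach_rect _ _ P lF) => {u v c}.
- by move=> u c c0; left; apply: reach_refl.
- move=> u z v c; rewrite finset.in_setU1 => /orP[/eqP uz|uz].
    have l0 : 0 <= l [set u; z] by rewrite uz; apply: lF; rewrite !inE eqxx.
    case: (eq_set2 uz) => -[? ?]; subst u z.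
      case=> [yv|[c1 [c2 [cc [[yx yv]|[yy xv]]]]]].
      + right; exists 0, c; split; first lra.
        by left; split=> //; apply: reach_refl.
      + have c10 := reach_ge0 lF' yx.
        right; exists 0, c2; split; first lra.
        by left; split=> //; apply: reach_refl.
      + have c10 := reach_ge0 lF' yy.
        by left; apply: reach_le xv; lra.
    case=> [xv|[c1 [c2 [cc [[xx yv]|[xy xv]]]]]].
    + right; exists 0, c; split; first by rewrite uz; lra.
      by right; split=> //; apply: reach_refl.
    + have c10 := reach_ge0 lF' xx.
      by left; apply: reach_le yv; rewrite uz in l0 *; lra.
    + have c10 := reach_ge0 lF' xy.
      right; exists 0, c2; split; first by rewrite uz in l0 *; lra.
      by right; split=> //; apply: reach_refl.
  case=> [zv|[c1 [c2 [cc H]]]]; first by left; apply: reach_cons.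
  right; exists (l [set u; z] + c1), c2; split; first lra.
  by case: H => [[? ?]|[? ?]]; [left|right]; split=> //; apply: reach_cons.
- move=> u v c c' cc [uv|[c1 [c2 [cc' H]]]]; first by left; apply: reach_le uv.
  by right; exists c1, c2; split=> //; apply: le_trans cc' cc.
Qed.

(** Cutting out the stretch between two visits of the same node never lengthens a walk. This leaves
    finitely many walks to consider. *)
Lemma reach_short l F u v c : nonneg_on l F -> reach l F u v c ->
  exists p : seq V, [/\ (size p <= #|V|)%N, is_walk F u v p & walk_length l u p <= c].
Proof.
move=> lF [p [pp pv] lp].
have [n] := ubnP (size p); elim: n => // n IH in p pp pv lp *.
rewrite ltnS => pn; have [sp|sp] := leqP (size p) #|V|; first by exists p.
have /(uniqPn u)[i [j [ij js nij]]] : ~~ uniq p.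
  by apply: contraL sp => up; rewrite -leqNgt -(card_uniqP up) max_card.
pose q := take i.+1 p ++ drop j.+1 p.
have ei : last u (take i.+1 p) = nth u p i.
  by rewrite (last_nth u) size_take (leq_ltn_trans ij js) /= nth_take.
have ej : last u (take j.+1 p) = nth u p j.
  have -> : take j.+1 p = take j p ++ [:: nth u p j].
    by rewrite (take_nth u js) cats1.
  by rewrite last_cat.
have pj : p = take j.+1 p ++ drop j.+1 p by rewrite cat_take_drop.
have ti : take j.+1 p = take i.+1 p ++ drop i.+1 (take j.+1 p).
  by rewrite -[LHS](cat_take_drop i.+1) take_takel // ltnW.
have := pp; rewrite {1}pj cat_path ej -nij => /andP[pp1 pp2].
have := pp1; rewrite ti cat_path => /andP[pp11 pp12].
apply: (IH q).
- by rewrite /q cat_path pp11 ei.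
- by rewrite /q last_cat ei nij -ej -last_cat -pj.
- apply: le_trans lp; rewrite [leRHS](congr1 (walk_length l u) pj).
  rewrite /q !walk_length_cat ei nij ej lerD2r ti.
  by rewrite walk_length_cat lerDl; apply: walk_length_ge0 pp12.
- apply: leq_trans pn; rewrite /q size_cat size_take size_drop.
  rewrite (leq_ltn_trans ij js) addnBA // ltn_subLR;
    last by rewrite (leq_trans js) // leq_addl.
  by rewrite addnC [ltnRHS]addnC ltn_add2l.
Qed.

(** By [reach_short] the infimum is governed by the finitely many walks of at most [#|V|] steps, so
    it is attained. *)
Lemma dist_le l F u v c : nonneg_on l F ->
  (dist F l u v <= c%:E)%E <-> reach l F u v c.
Proof.
move=> lF; split; last first.
  move=> [p pw lp]; apply: le_trans (_ : (walk_length l u p)%:E <= _)%E.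
    by apply: ereal_inf_lbound; exists p.
  by rewrite lee_fin.
move=> dc; apply: contrapT => nr.
pose W := [pred p : {bseq #|V| of V} | path (adj F) u p && (last u p == v)].
have Wc (p : {bseq #|V| of V}) : W p -> c < walk_length l u p.
  case/andP=> pp /eqP pv; rewrite ltNge; apply/negP => lp.
  by apply: nr; exists p.
have key c' : (forall p : {bseq #|V| of V}, W p -> c' <= walk_length l u p) -> (c'%:E
  <= dist F l u v)%E.
  move=> Wc'; apply: le_ereal_inf_tmp => _ [p /= pw <-]; rewrite lee_fin.
  have [q [qs [q1 q2] ql]] := reach_short lF (ex_intro2 _ _ p pw (lexx _)).
  by apply: le_trans ql; apply: (Wc' (Bseq qs)); rewrite /W /= q1 q2 eqxx.
have [/existsP[b0 b0W]|/existsPn noW] := boolP [exists b, W b].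
  have [b bW bmin] :=
    @arg_minP _ R _ b0 W (fun b => walk_length l u (bseqval b)) b0W.
  have := le_trans (key _ bmin) dc; rewrite lee_fin.
  by rewrite leNgt Wc.
(* Without any walk every real is a lower bound of the distance; [c + 1] already contradicts
   [dc]. *)
have := key (c + 1) (fun b bW => False_ind _ (negP (noW b) bW)).
by move=> /le_trans/(_ dc); rewrite lee_fin; lra.
Qed.

Lemma dist_fin l F u v : nonneg_on l F -> connect (adj F) u v ->
  exists c, dist F l u v = c%:E.
Proof.
move=> lF /(connect_reach l)[c] /(dist_le _ _ _ lF) dc.
case E: (dist F l u v) => [r| |]; [by exists r|by rewrite E in dc|].
have : (dist F l u v <= (-1)%:E)%E by rewrite E leNye.
by move=> /(dist_le _ _ _ lF)/(reach_ge0 lF); lra.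
Qed.

Lemma dist_eq l F u v c : nonneg_on l F -> reach l F u v c ->
  (forall c', reach l F u v c' -> c <= c') -> dist F l u v = c%:E.
Proof.
move=> lF rc cmin; have [d dE] := dist_fin lF (reach_connect rc).
have dc : (dist F l u v <= c%:E)%E by apply/dist_le.
have : (dist F l u v <= d%:E)%E by rewrite dE.
move=> /(dist_le _ _ _ lF)/cmin cd; rewrite dE; congr EFin; apply/eqP.
by rewrite eq_le cd andbT -lee_fin -dE.
Qed.

End Walks.

(** * Minimum spanning trees and their traversal *)

Section MinimumSpanningTrees.
Variables (R : realType) (V : finType).
Implicit Types (E F G H T : {set {set V}}) (l : {set V} -> R) (u v x y : V).
Implicit Types (S : {set V}) (c : R).

Lemma connect_crossing G S u v : connect (adj G) u v -> u \in S -> v \notin S ->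
  exists x y, [/\ x \in S, y \notin S & [set x; y] \in G].
Proof.
case/connectP=> p; elim: p u => [|x p IH] u /=; first by move=> _ -> ->.
case/andP=> ux xp vE uS vS; have [xS|xS] := boolP (x \in S); last by exists u, x.
exact: (IH x xp vE xS vS).
Qed.

Lemma connectedD1 F u v : connected_graph F ->
  connect (adj (F :\ [set u; v])) u v -> connected_graph (F :\ [set u; v]).
Proof.
move=> cF uv x y; move: (cF x y); apply: connect_sub => {x y} a b ab.
have [abE|abN] := eqVneq [set a; b] [set u; v]; last first.
  by apply: connect1; rewrite /adj !inE abN.
have : a \in [set u; v] by rewrite -abE !inE eqxx.
have : b \in [set u; v] by rewrite -abE !inE eqxx orbT.
rewrite !inE; do 2 case/orP=> /eqP->; rewrite ?connect0 //.
by rewrite connect_adjC.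
Qed.

(** Without [uv] every node is still joined to [u] or to [v]. As [b] is not on the side of [u], it
    is on that of [v], and [ab] joins the two sides again. *)
Lemma connected_exchange F u v a b : connected_graph F ->
  connect (adj (F :\ [set u; v])) u a -> ~~ connect (adj (F :\ [set u; v])) u b ->
  connected_graph ([set a; b] |: F :\ [set u; v]).
Proof.
move=> cF ua ub; set e := [set u; v] in ua ub *; set G := _ :\ e in ua ub *.
have GF : subrel (connect (adj G)) (connect (adj ([set a; b] |: G))).
  apply: connect_sub => x y xy; apply: connect1.
  by move: xy; rewrite /adj !inE => ->; rewrite orbT.
have ab : connect (adj ([set a; b] |: G)) a b.
  by apply: connect1; rewrite /adj !inE eqxx.
have Fx x : connect (adj G) u x || connect (adj G) v x.
  have := cF x u; case/connectP=> p; elim: p x => [|y p IH] x /=.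
    by move=> _ ->; rewrite connect0.
  case/andP=> xy yp uE; have := IH y yp uE.
  have [xye|xyN] := eqVneq [set x; y] e.
    have : x \in e by rewrite -xye !inE eqxx.
    by rewrite !inE => /orP[]/eqP->; rewrite connect0 ?orbT.
  have yx : connect (adj G) y x.
    by rewrite connect_adjC; apply: connect1; rewrite /adj !inE xyN.
  by case/orP=> uy; rewrite (connect_trans uy yx) ?orbT.
have vb : connect (adj G) v b by have := Fx b; rewrite (negPf ub).
have uv' : connect (adj ([set a; b] |: G)) u v.
  apply: connect_trans (GF _ _ ua) (connect_trans ab _).
  by apply: GF; rewrite connect_adjC.
have ux x : connect (adj ([set a; b] |: G)) u x.
  by case/orP: (Fx x) => /GF // vx; apply: connect_trans uv' vx.
by move=> x y; apply: connect_trans (ux y); rewrite connect_adjC.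
Qed.

Lemma minimal_connected_acyclic F : F \subset complete_edges V ->
  connected_graph F -> (forall e, e \in F -> ~ connected_graph (F :\ e)) ->
  acyclic F.
Proof.
move=> FV cF Fmin [|x [|y [|z p]]] //= /andP[/=]; rewrite /cycle /=.
case/and3P=> xy yz zp /and3P[xN yN up]; exfalso.
apply: (Fmin _ xy); apply: connectedD1 => //.
move: xN yN; rewrite !inE !negb_or => /and3P[nxy nxz xp] /andP[nyz yp].
rewrite connect_adjC; apply: (@connect_trans _ _ z).
  apply: connect1; move: yz; rewrite /adj !inE => ->; rewrite andbT.
  apply/eqP=> /setP/(_ z); rewrite !inE eqxx orbT.
  by rewrite (eq_sym z x) (negPf nxz) eq_sym (negPf nyz).
apply/connectP; exists (rcons p x); last by rewrite last_rcons.
(* The cycle from [z] on to [x] does not meet [y], so it survives the deletion of [xy] and bypasses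
   that edge. *)
have yp' : y \notin z :: rcons p x.
  by rewrite inE mem_rcons inE !negb_or nyz yp eq_sym nxy.
move: (rcons p x) z yp' zp {yz nxz nyz up xp nxy yp} => {p}.
elim=> [|a q IH] z //=; rewrite !inE !negb_or => /and3P[yz ya yq] /andP[za aq].
rewrite IH ?inE ?negb_or ?ya //; move: za; rewrite /adj !inE => ->; rewrite !andbT.
apply/eqP=> /setP/(_ y); rewrite !inE eqxx orbT.
by rewrite (negPf yz) (negPf ya).
Qed.

Lemma weightD1 l F e : e \in F -> weight l F = l e + weight l (F :\ e).
Proof. by move=> eF; rewrite /weight (big_setD1 e). Qed.

Lemma weightU1 l F e : e \notin F -> weight l (e |: F) = l e + weight l F.
Proof. by move=> eF; rewrite /weight big_setU1. Qed.

Lemma weightS l F G : F \subset G -> nonneg_on l G -> weight l F <= weight l G.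
Proof.
move=> FG lG; rewrite /weight [leRHS](big_setID F) /=.
rewrite (finset.setIidPr FG) lerDl.
by apply: sumr_ge0 => e; rewrite inE => /andP[_ /lG].
Qed.

Lemma weight_ge0 l F : nonneg_on l F -> 0 <= weight l F.
Proof. by move=> lF; apply: sumr_ge0. Qed.

Lemma weight_edge l F e : nonneg_on l F -> e \in F -> l e <= weight l F.
Proof.
move=> lF eF; rewrite (weightD1 _ eF) lerDl weight_ge0 // => f.
by rewrite !inE => /andP[_ /lF].
Qed.

(** Minimizing over connected subgraphs instead of trees spares acyclicity in exchange arguments;
    positive lengths make a minimizer a minimum spanning tree, see [mst_weightE]. *)
Definition minimum_connected E l F : Prop :=
  [/\ F \subset E, connected_graph F &
      forall G, G \subset E -> connected_graph G -> weight l F <= weight l G].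

Lemma minimum_connected_exists E l : connected_graph E ->
  exists F, minimum_connected E l F.
Proof.
move=> cE; pose P F := (F \subset E) && `[< connected_graph F >].
have PE : P E by rewrite /P fintype.subxx; apply/asboolP.
have [F /andP[FE /asboolP cF] Fmin] := @arg_minP _ R _ E P (weight l) PE.
exists F; split=> // G GE cG; apply: Fmin; rewrite /P GE; exact/asboolP.
Qed.

Lemma spanner_instance_nonneg E l : spanner_instance E l -> nonneg_on l E.
Proof. by case=> _ _ l0 e /l0/ltW. Qed.

Lemma mst_weightE E l F : spanner_instance E l -> minimum_connected E l F ->
  mst_weight E l = weight l F.
Proof.
move=> [EV _ l0] [FE cF Fmin].
have stF : spanning_tree E F.
  split=> //; apply: minimal_connected_acyclic => //.
    exact: fintype.subset_trans EV.
  move=> e eF cFe; have := Fmin _ (fintype.subset_trans (finset.subsetDl _ _) FE) cFe.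
  by rewrite (weightD1 _ eF) gerDr leNgt l0 // (fintype.subsetP FE).
apply/eqP; rewrite eq_le; apply/andP; split.
  apply: ge_inf; last by exists F.
  by exists (weight l F) => _ [T [TE cT _] <-]; apply: Fmin.
apply: lb_le_inf; first by exists (weight l F), F.
by move=> _ [T [TE cT _] <-]; apply: Fmin.
Qed.

(* Growing a tree from a node as in Prim's algorithm: a new node [x], attached
   to [y] by an edge of length [a], is placed at distance [a] to the right of
   [y], and everything to the right of [y] is shifted by [2 a]. *)
Lemma tour_embedding T l : connected_graph T -> nonneg_on l T ->
  exists pos : V -> R, forall u v,
    [/\ 0 <= pos u <= 2 * weight l T, reach l T u v `|pos u - pos v|
      & reach l T u v (weight l T)].
Proof.
move=> cT lT.
case: (pickP (@predT V)) => [x0 _|V0]; last by exists (fun=> 0) => u; have := V0 u.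
pose inv S F (pos : V -> R) := [/\ x0 \in S, F \subset T,
  forall e, e \in F -> e \subset S,
  forall u, u \in S -> 0 <= pos u <= 2 * weight l F &
  {in S &, forall u v, reach l T u v `|pos u - pos v| /\ reach l T u v (weight l F)}].
suff step S F pos : inv S F pos -> exists pos : V -> R, forall u v,
    [/\ 0 <= pos u <= 2 * weight l T, reach l T u v `|pos u - pos v|
      & reach l T u v (weight l T)].
  apply: (step [set x0] finset.set0 (fun=> 0)); split.
  - by rewrite inE.
  - by rewrite finset.sub0set.
  - by move=> e; rewrite inE.
  - by move=> u _; rewrite /weight big_set0 mulr0 lexx.
  - move=> u v; rewrite !inE => /eqP-> /eqP->; rewrite /weight big_set0 subrr normr0.
    by split; apply: reach_refl.
have [n] := ubnP #|~: S|; elim: n => // n IH in S F pos *; rewrite ltnS => Sn Sinv.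
have [x0S FT FS posS reachS'] := Sinv.
have lF : nonneg_on l F by move=> e /(fintype.subsetP FT)/lT.
have [ST|[x xS]] : S = [set: V] \/ exists x, x \notin S.
    case: (pickP [pred x | x \notin S]) => [x xS|S0]; [by right; exists x|left].
    by apply/setP => x; rewrite inE; have := S0 x; rewrite /= => /negbFE.
  exists pos => u v; have uS : u \in S by rewrite ST inE.
  have vS : v \in S by rewrite ST inE.
  have wF := weightS FT lT.
  have [r1 r2] := reachS' _ _ uS vS; split=> //; last exact: reach_le r2.
  have /andP[-> p2] := posS u uS; apply: le_trans p2 _.
  by rewrite ler_pM2l.
have [y [z [yS zS yzT]]] := connect_crossing (cT x0 x) x0S xS.
have a0 := lT _ yzT; set a := l [set y; z] in a0.
have eF : [set y; z] \notin F.
  apply: contra zS => /FS/fintype.subsetP; apply.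
  by rewrite !inE eqxx orbT.
pose pos' v := if v == z then pos y + a else
  if pos v <= pos y then pos v else pos v + 2 * a.
have posz : pos' z = pos y + a by rewrite /pos' eqxx.
have posv v : v \in S -> pos' v = if pos v <= pos y then pos v else pos v + 2 * a.
  by move=> vS; rewrite /pos'; case: eqP => // vz; rewrite -vz vS in zS.
have Fz : weight l ([set y; z] |: F) = a + weight l F by rewrite weightU1.
have rz v : v \in S -> reach l T v z `|pos' v - pos' z| /\
    reach l T v z (a + weight l F).
  move=> vS; have [r1 r2] := reachS' _ _ vS yS.
  split; last by rewrite addrC; apply: reach_trans r2 (reach_edge _ yzT).
  (* The walk to [z] runs through [y]. On either side of [y], the new position of [v] is farther
     from that of [z] than [pos v] was from [pos y], by exactly [a]. *)
  apply: reach_le (reach_trans r1 (reach_edge _ yzT)).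
  rewrite posz posv // -/a; case: (leP (pos v)) => vy.
    rewrite ler0_norm; last lra.
    by rewrite ler0_norm; lra.
  rewrite ger0_norm; last lra.
  by rewrite ger0_norm; lra.
apply: (IH (z |: S) ([set y; z] |: F) pos').
  apply: leq_trans Sn; apply: proper_card; rewrite finset.properC.
  by rewrite finset.properUr // finset.sub1set.
split.
- by rewrite !inE x0S orbT.
- by rewrite finset.subUset FT finset.sub1set yzT.
- move=> e; rewrite !inE => /orP[/eqP->|/FS eS].
    by rewrite finset.subUset !finset.sub1set !inE yS eqxx orbT.
  by apply: fintype.subset_trans eS _; rewrite finset.subsetUr.
- rewrite Fz => u; rewrite inE => /orP[|uS].
    by rewrite inE => /eqP->; rewrite posz; have /andP[? ?] := posS y yS; lra.
  rewrite posv //; have /andP[? ?] := posS u uS.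
  by case: (leP (pos u)) => _; lra.
- move=> u v; rewrite Fz !inE => /orP[/eqP->|uS] /orP[/eqP->|vS].
  + by rewrite subrr normr0; split; apply: reach_refl; rewrite ?addr_ge0 ?weight_ge0.
  + have [r1 r2] := rz _ vS; rewrite distrC.
    by split; apply: reach_sym.
  + exact: rz.
  + have [r1 r2] := reachS' _ _ uS vS; split; last first.
      by apply: reach_le r2; rewrite lerDr.
    apply: reach_le r1; rewrite !posv //.
    case: (leP (pos u)) => uy; case: (leP (pos v)) => vy //.
    * rewrite ler0_norm; last lra.
      by rewrite ler0_norm; lra.
    * rewrite ger0_norm; last lra.
      by rewrite ger0_norm; lra.
    * by rewrite opprD addrACA subrr addr0.
Qed.

End MinimumSpanningTrees.

(** * The greedy algorithm *)

Section GreedySpanners.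
Variables (R : realType) (V : finType).
Implicit Types (E F G H T : {set {set V}}) (l : {set V} -> R) (u v x y : V).
Implicit Types (c alpha : R) (p : seq V) (s : seq (V * V)).

Definition critical alpha l H : Prop := forall u v, [set u; v] \in H ->
  ~ reach l (H :\ [set u; v]) u v (alpha * l [set u; v]).

Definition edges_upto l H c : {set {set V}} := [set f in H | l f <= c].

(** The restriction to edges no longer than [uv] does double work: it permits exchanges that do not
    increase the weight of a tree, and it keeps the walk clear of any given longer edge. *)
Definition locally_spanning alpha l E H : Prop := forall u v, [set u; v] \in E ->
  reach l (edges_upto l H (l [set u; v])) u v (alpha * l [set u; v]).

Lemma path_adjE F u p : path (adj F) u p = all (mem F) (walk_edges u p).
Proof. by elim: p u => [|x p IH] u //=; rewrite IH. Qed.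

Lemma walk_length_gt l F u p e : (forall f, f \in F -> 0 < l f) ->
  path (adj F) u p -> (1 < size p)%N -> e \in walk_edges u p ->
  l e < walk_length l u p.
Proof.
rewrite path_adjE /walk_length => l0 /allP pF sp ep.
rewrite (big_rem e) //= ltrDl.
have : (0 < size (rem e (walk_edges u p)))%N.
  by rewrite size_rem // size_pairmap; case: (size p) sp => // -[].
have : {subset rem e (walk_edges u p) <= F}.
  by move=> f /mem_rem/pF.
case: (rem _ _) => // f fs fF _; rewrite big_cons ltr_pwDl //.
  by apply/l0/fF; rewrite inE eqxx.
rewrite big_seq_cond; apply: sumr_ge0 => g; rewrite andbT => gfs.
by apply/ltW/l0/fF; rewrite inE gfs orbT.
Qed.

Lemma reach_subst l F G alpha u v c : 0 <= alpha -> nonneg_on l F ->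
  (forall x y, [set x; y] \in F -> reach l G x y (alpha * l [set x; y])) ->
  reach l F u v c -> reach l G u v (alpha * c).
Proof.
move=> a0 lF FG; pose P u v c := reach l G u v (alpha * c).
apply: (@reach_rect _ _ l F P lF) => {u v c} [u c c0|u x v c ux xv|u v c c' cc].
- by apply: reach_refl; rewrite mulr_ge0.
- by rewrite /P mulrDr; apply: reach_trans xv; apply: FG.
- by apply: reach_le; rewrite ler_wpM2l.
Qed.

Lemma edges_uptoS l H c c' : c <= c' -> edges_upto l H c \subset edges_upto l H c'.
Proof.
move=> cc; apply/fintype.subsetP => e; rewrite !inE => /andP[-> ec].
exact: le_trans ec cc.
Qed.

Section Instance.
Variables (E : {set {set V}}) (l : {set V} -> R).
Hypothesis El : spanner_instance E l.

Let lE : nonneg_on l E. Proof. exact: spanner_instance_nonneg. Qed.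
Let M := metric_edges E l.

Lemma edge_irrefl u v : [set u; v] \in E -> u != v.
Proof.
case: El => /fintype.subsetP EV _ _ /EV; rewrite inE; apply: contraTneq => ->.
by rewrite finset.setUid cards1.
Qed.

Lemma metric_edgesP e : reflect
  (e \in E /\ forall u v, e = [set u; v] -> ~ reach l (E :\ e) u v (l e))
  (e \in M).
Proof.
have lEe f : nonneg_on l (E :\ f) by move=> g; rewrite !inE => /andP[_ /lE].
rewrite inE; apply: (iffP andP) => -[eE H]; split=> //.
  move=> u v euv; move/forallP/(_ u)/forallP/(_ v): H.
  by rewrite euv eqxx /= ltNge => /negP H /(dist_le _ _ _ (lEe _)).
apply/forallP => u; apply/forallP => v; apply/implyP => /eqP euv.
by rewrite ltNge; apply/negP => /(dist_le _ _ _ (lEe _)); apply: H.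
Qed.

Lemma metric_edges_sub : M \subset E.
Proof. by apply/fintype.subsetP => e /metric_edgesP[]. Qed.

(** Otherwise [e] is outside a minimum tree, and the tree joins its ends by a walk shorter than [e].
    This is why raising the threshold to the weight of that tree keeps all terminal pairs as
    edges. *)
Lemma metric_edge_le_mst e : e \in M -> l e <= mst_weight E l.
Proof.
have [_ cE _] := El; have [F Fmin] := minimum_connected_exists l cE.
rewrite (mst_weightE El Fmin); case: Fmin => FE cF _ /metric_edgesP[eE eM].
have lF : nonneg_on l F by move=> f /(fintype.subsetP FE)/lE.
have [eF|eF] := boolP (e \in F); first exact: weight_edge.
case: El => /fintype.subsetP/(_ _ eE) + _ _; rewrite inE => /cards2P[u [v [uv euv]]].
rewrite leNgt; apply/negP => /ltW Fe; apply: (eM u v euv).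
have [pos /(_ u v)[_ _]] := tour_embedding cF lF.
move/(reach_le Fe); apply: reachS; apply/fintype.subsetP => f fF.
by rewrite !inE (fintype.subsetP FE) // andbT; apply: contraNneq eF => <-.
Qed.

(** A competing walk either contains the edge and something more, hence is longer, or avoids it and
    contradicts metricity. So the greedy algorithm adds single edges only. *)
Lemma metric_edge_walk F u v p : F \subset E -> [set u; v] \in M ->
  is_walk F u v p -> walk_length l u p <= l [set u; v] -> p = [:: v].
Proof.
have [_ _ l0] := El => FE /metric_edgesP[eE eM] [pp pv] lp.
have pE : path (adj E) u p by apply: sub_path pp => x y; apply: (fintype.subsetP FE).
have [ep|ep] := boolP ([set u; v] \in walk_edges u p).
  case: p ep pp pv lp pE => [|x [|y p]] //= ep pp pv lp pE; first by rewrite pv.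
  by have := walk_length_gt (p := [:: x, y & p]) l0 pE isT ep; rewrite ltNge lp.
case: (eM u v) => //; exists p => //; split=> //.
move: pE; rewrite !path_adjE => /allP pE; apply/allP => f fp.
have fE : f \in E by apply: pE.
by rewrite /= !inE fE andbT; apply: contraNneq ep => <-.
Qed.

Lemma metric_edge_dist F u v : F \subset E -> [set u; v] \in M ->
  [set u; v] \in F -> dist F l u v = (l [set u; v])%:E.
Proof.
move=> FE uvM uvF; have lF : nonneg_on l F by move=> f /(fintype.subsetP FE)/lE.
apply: dist_eq => //; first exact: reach_edge.
move=> c [p pw lp]; rewrite leNgt; apply/negP => cl.
have pl := ltW (le_lt_trans lp cl).
move: lp; rewrite (metric_edge_walk FE uvM pw pl).
by rewrite walk_length_cons walk_length_nil addr0 leNgt cl.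
Qed.

(** Induction on the number of shorter edges: the ends of a nonmetric edge are joined by a walk that
    is no longer and has at least two edges, so all of its edges are strictly shorter. *)
Lemma metric_edges_locally_spanning : locally_spanning 1 l E M.
Proof.
have [_ _ l0] := El; move=> u v; rewrite mul1r; move eE : [set u; v] => e.
have [n] := ubnP #|[set f in E | l f < l e]|.
elim: n => // n IH in u v e eE *; rewrite ltnS => en euE.
have [eM|eM] := boolP (e \in M).
  by rewrite -{2}eE; apply: reach_edge; rewrite eE inE eM /=.
have [p [pp pv] lp] : reach l (E :\ e) u v (l e).
  apply: contrapT => nr; move/negP: eM; apply; apply/metric_edgesP; split=> //.
  by move=> x y; rewrite -{1}eE => /eq_set2[][<- <-] // /reach_sym.
have sp : (1 < size p)%N.
  case: p pp pv {lp} => [|x [|y p]] //= pp pv.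
    by have := edge_irrefl (u := u) (v := v); rewrite eE pv eqxx => /(_ euE).
  by move: pp; rewrite pv /adj !inE eE eqxx.
have pE : path (adj E) u p by apply: sub_path pp => x y; rewrite /adj !inE => /andP[].
have pr : reach l [set f in E | l f < l e] u v (l e).
  exists p => //; split=> //; rewrite path_adjE; apply/allP => f fp.
  have fE : f \in E by move: pE; rewrite path_adjE => /allP/(_ f fp).
  rewrite /= inE fE /=.
  exact: lt_le_trans (walk_length_gt l0 pE sp fp) lp.
rewrite -{2}[l e]mul1r; apply: reach_subst pr => //; first by move=> f;
  rewrite inE => /andP[/lE].
move=> x y; rewrite mul1r inE => /andP[xyE xye].
apply: (@reachS _ _ _ (edges_upto l M (l [set x; y]))).
  exact/edges_uptoS/ltW.
apply: IH => //; apply: leq_trans en; apply: proper_card.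
apply/properP; split.
  by apply/fintype.subsetP => f; rewrite !inE => /andP[-> /lt_trans]; apply.
by exists [set x; y]; rewrite !inE ?ltxx ?andbF // xyE.
Qed.

Lemma greedy_run alpha delta sp s : 1 <= alpha ->
  (forall q, q \in s -> [/\ [set q.1; q.2] \in M, sp q.1 q.2 = [:: q.2] &
     delta q.1 q.2 = (alpha * l [set q.1; q.2])%:E]) ->
  sorted (fun q r => l [set q.1; q.2] <= l [set r.1; r.2]) s ->
  let H := foldl (greedy_step l delta sp) finset.set0 s in
  [/\ forall e, e \in H -> exists2 q, q \in s & e = [set q.1; q.2],
      critical alpha l H
    & forall q, q \in s ->
        reach l (edges_upto l H (l [set q.1; q.2])) q.1 q.2 (alpha * l [set q.1; q.2])].
Proof.
move=> a1; set leq_l := fun q r : V * V => _.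
have tr : transitive leq_l by move=> q r t; apply: le_trans.
elim/last_ind: s => [|s q IH] sM.
  by move=> _ H; split=> [e||q] //; rewrite ?inE // => u v; rewrite inE.
rewrite sorted_pairwise // pairwise_rcons => /andP[/allP sq].
rewrite -sorted_pairwise // => ss; rewrite foldl_rcons.
have {IH} := IH _ ss; set H := foldl _ _ _ => IH.
have [|Hs Hc Hr] := IH; first by move=> r rs; apply: sM; rewrite mem_rcons inE rs orbT.
have [qM spq dq] : [/\ [set q.1; q.2] \in M, sp q.1 q.2 = [:: q.2] &
     delta q.1 q.2 = (alpha * l [set q.1; q.2])%:E].
  by apply: sM; rewrite mem_rcons inE eqxx.
set e := [set q.1; q.2] in qM dq *.
have sE r : r \in s -> [set r.1; r.2] \in E.
  move=> rs; apply: (fintype.subsetP metric_edges_sub).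
  by have [] := sM r; rewrite // mem_rcons inE rs orbT.
have eE := fintype.subsetP metric_edges_sub _ qM.
have lH : nonneg_on l H by move=> f /Hs[r /sE rE ->]; apply: lE.
have He f : f \in H -> l f <= l e by move=> /Hs[r rs ->]; apply: sq.
rewrite /greedy_step; case: ifPn; rewrite dq; last first.
  rewrite -leNgt => /(dist_le _ _ _ lH) He'; split=> //.
    by move=> f /Hs[r rs ->]; exists r => //; rewrite mem_rcons inE rs orbT.
  move=> r; rewrite mem_rcons inE => /orP[/eqP->|]; last exact: Hr.
  by apply: reachS He'; apply/fintype.subsetP => f fH; rewrite inE fH He.
rewrite spq /= -/e ltNge => /negP nr.
have -> : H :|: [set f in [:: e]] = e |: H.
  by rewrite finset.setUC; congr (_ :|: _); apply/setP => f; rewrite !inE.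
have {}nr : ~ reach l H q.1 q.2 (alpha * l e) by move=> /(dist_le _ _ _ lH).
have e0 := lE eE.
have leH : nonneg_on l (e |: H) by move=> f; rewrite !inE => /orP[/eqP->|/lH].
split.
- move=> f; rewrite !inE => /orP[/eqP->|].
    by exists q => //; rewrite mem_rcons inE eqxx.
  by move=> /Hs[r rs ->]; exists r => //; rewrite mem_rcons inE rs orbT.
- move=> u v uv.
  have [uve|uve] := eqVneq [set u; v] e.
    rewrite uve => ruv; apply: nr.
    have {}ruv : reach l H u v (alpha * l e).
      apply: reachS ruv; apply/fintype.subsetP => f; rewrite !inE.
      by case: (f == e).
    by case: (eq_set2 uve) => -[<- <-] //; apply: reach_sym.
  have uvH : [set u; v] \in H by move: uv; rewrite !inE (negPf uve).
  set f := [set u; v] in uve uvH *.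
  have fe := He _ uvH.
  have -> : (e |: H) :\ f = e |: (H :\ f).
    apply/setP => g; rewrite !inE; have [->|gf] := eqVneq g f; last by [].
    by rewrite (negPf uve).
  move=> ruv; have lHf : nonneg_on l (e |: H :\ f).
    by move=> g; rewrite !inE => /orP[/eqP->|/andP[_ /lH]].
  have HfH : H :\ f \subset H by apply: finset.subsetDl.
  (* A new short walk between the ends of [f] crosses [e]. Exchanging the roles of the two edges
     gives a walk between the ends of [e] of length [c1 + l f + c2], at most [alpha * l e] since
     [l f <= l e]; then [e] would not have been added. *)
  case: (reach_split lHf ruv) => [|[c1 [c2 [cc H12]]]]; first exact: Hc.
  have fuv : reach l H u v (l f) by apply: reach_edge.
  apply: nr; apply: (@reach_le _ _ _ _ _ _ (c1 + l f + c2)).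
    have : alpha * l f <= alpha * l e by apply: ler_wpM2l => //; lra.
    rewrite -/e in cc; lra.
  case: H12 => -[r1 r2]; have {}r1 := reachS HfH r1; have {}r2 := reachS HfH r2.
    exact: reach_trans (reach_trans (reach_sym r1) fuv) (reach_sym r2).
  apply: reach_sym.
  exact: reach_trans (reach_trans (reach_sym r1) fuv) (reach_sym r2).
- move=> r; rewrite mem_rcons inE => /orP[/eqP->|rs].
    apply: (@reach_le _ _ _ _ _ _ (l e)); first by rewrite ler_peMl.
    by apply: reach_edge; rewrite !inE eqxx /=.
  apply: reachS (Hr r rs); apply/fintype.subsetP => f.
  by rewrite !inE => /andP[-> ->]; rewrite orbT.
Qed.

End Instance.

(** All metric edges pass the threshold and have their own length as distance in the light subgraph
    and in [E], so the run satisfies the assumptions of [greedy_run]. Other edges are served by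
    walks of metric edges that are no longer than they are. *)
Lemma augmented_greedy_critical alpha E l H : 1 <= alpha ->
  spanner_instance E l -> augmented_greedy_spanner alpha E l H ->
  [/\ H \subset metric_edges E l, critical alpha l H & locally_spanning alpha l E H].
Proof.
move=> a1 El [s [sp [[sK ss] spE HE]]].
have lE := spanner_instance_nonneg El.
set F := light_subgraph _ _ _ in ss spE.
have FE : F \subset E by apply/fintype.subsetP => f; rewrite inE => /andP[].
have lF : nonneg_on l F by move=> f /(fintype.subsetP FE)/lE.
have MF : metric_edges E l \subset F.
  apply/fintype.subsetP => e eM; rewrite inE (fintype.subsetP (metric_edges_sub El)) //=.
  by rewrite /what le_max metric_edge_le_mst ?orbT.
have sM q : (q \in s) -> [set q.1; q.2] \in metric_edges E l.
  move=> qs; rewrite -mem_enum -(perm_mem sK).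
  by apply: (map_f (fun q : V * V => [set q.1; q.2])).
have sF q : (q \in s) -> dist F l q.1 q.2 = (l [set q.1; q.2])%:E.
  by move=> /sM qM; apply: (metric_edge_dist El FE qM); apply: (fintype.subsetP MF).
have [||Hs Hc Hr] := greedy_run El (delta := demand alpha E l) (sp := sp) (s := s) a1.
- move=> q qs; have qM := sM _ qs; have qF := fintype.subsetP MF _ qM; split=> //.
    have [w wl _ _] := spE q.1 q.2 (connect1 qF).
    by apply: (metric_edge_walk El FE qM w); rewrite -lee_fin wl sF.
  by rewrite /demand (metric_edge_dist El (fintype.subxx E) qM) //
    (fintype.subsetP (metric_edges_sub El)).
- have : all (fun q => q \in s) s by apply/allP.
  move=> sall; apply: (sub_in_sorted _ sall ss).
  by move=> q r qs rs; rewrite !sF // lee_fin.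
rewrite -HE in Hs Hc Hr; split=> //.
  by apply/fintype.subsetP => e /Hs[q /sM qM ->].
have HM u v : [set u; v] \in metric_edges E l ->
    reach l (edges_upto l H (l [set u; v])) u v (alpha * l [set u; v]).
  move=> uvM; have : [set u; v] \in [seq [set q.1; q.2] | q <- s].
    by rewrite (perm_mem sK) mem_enum.
  case/mapP=> q qs uvq; have := Hr q qs; rewrite -uvq.
  by case: (eq_set2 uvq) => -[-> ->] //; apply: reach_sym.
move=> u v uvE; have := metric_edges_locally_spanning El uvE; rewrite mul1r.
apply: reach_subst; first lra.
  by move=> f; rewrite !inE => /andP[/andP[/lE]].
move=> x y; rewrite inE => /andP[/HM + xy]; apply: reachS.
exact: edges_uptoS.
Qed.

Lemma locally_spanning_reach alpha E l H u v c : 0 <= alpha -> nonneg_on l E ->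
  locally_spanning alpha l E H -> reach l E u v c -> reach l H u v (alpha * c).
Proof.
move=> a0 lE HE; apply: reach_subst => // x y /HE; apply: reachS.
by apply/fintype.subsetP => f; rewrite inE => /andP[].
Qed.

Lemma locally_spanning_is_spanner alpha E l H : 0 <= alpha ->
  spanner_instance E l -> H \subset E -> locally_spanning alpha l E H ->
  is_spanner alpha E l H.
Proof.
move=> a0 El HsE HE; have lE := spanner_instance_nonneg El.
have lH : nonneg_on l H by move=> f /(fintype.subsetP HsE)/lE.
rewrite /is_spanner /feasible HsE; apply/forallP => u; apply/forallP => v.
have [_ cE _] := El; rewrite /demand; have [c cdist] := dist_fin lE (cE u v).
rewrite cdist -EFinM; apply/(dist_le _ _ _ lH).
apply: (locally_spanning_reach a0 lE HE).
by apply/(dist_le _ _ _ lE); rewrite cdist.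
Qed.

(** Take a minimum connected subgraph with as many edges in [H] as possible. If it has an edge [e]
    outside [H], the walk in [H] between the ends of [e] crosses the cut left by deleting [e]; the
    crossing edge is no longer than [e], and exchanging the two contradicts maximality. *)
Lemma locally_spanning_connected alpha E l H F : spanner_instance E l ->
  H \subset E -> locally_spanning alpha l E H -> minimum_connected E l F ->
  exists T, [/\ T \subset H, connected_graph T & weight l T = weight l F].
Proof.
move=> El HE Hls [FE cF Fmin]; have [_ _ l0] := El.
pose P T := [&& T \subset E, `[< connected_graph T >] & weight l T == weight l F].
have PF : P F by rewrite /P FE eqxx andbT; apply/asboolP.
have [T /and3P[TE /asboolP cT /eqP wT] Tmax] :=
  @arg_maxnP _ F P (fun T => #|T :&: H|) PF.
exists T; split=> //; apply/fintype.subsetP => e eT; apply: contrapT => /negP eH.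
have eE := fintype.subsetP TE _ eT.
case: (El) => /fintype.subsetP/(_ _ eE) + _ _; rewrite inE => /cards2P[u [v [uv euv]]].
subst e; set e := [set u; v] in eT eE eH.
have nuv : ~~ connect (adj (T :\ e)) u v.
  apply/negP => /(connectedD1 cT) cTe.
  have := Fmin _ (fintype.subset_trans (finset.subsetDl _ _) TE) cTe.
  by rewrite -wT (weightD1 _ eT) gerDr leNgt l0.
have uS : u \in [set x | connect (adj (T :\ e)) u x] by rewrite inE connect0.
have vS : v \notin [set x | connect (adj (T :\ e)) u x] by rewrite inE.
have [a [b []]] := connect_crossing (reach_connect (Hls _ _ eE)) uS vS.
rewrite !inE => ua ub /andP[abH abe].
set f := [set a; b] in abH abe.
have fT : f \notin T :\ e.
  by apply: contra ub => fT; apply: connect_trans ua (connect1 _).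
pose T' := f |: T :\ e.
have T'E : T' \subset E.
  rewrite finset.subUset finset.sub1set (fintype.subsetP HE) //=.
  exact: fintype.subset_trans (finset.subsetDl _ _) TE.
have cT' : connected_graph T' by apply: connected_exchange.
have wT' : weight l T' <= weight l T.
  by rewrite /T' (weightU1 _ fT) (weightD1 _ eT) lerD2r.
have PT' : P T'.
  rewrite /P T'E eq_le -{1}wT wT' Fmin //= andbT; exact/asboolP.
have : (#|T' :&: H| <= #|T :&: H|)%N by apply: Tmax.
rewrite leqNgt => /negP; apply; apply: proper_card.
apply/properP; split.
  apply/fintype.subsetP => g; rewrite !inE => /andP[gT gH]; rewrite gT gH !andbT.
  by apply/orP; right; apply: contraNneq eH => <-.
exists f; first by rewrite !inE eqxx abH.
apply: contra fT; rewrite !inE => /andP[-> _]; rewrite andbT.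
by apply: contraNneq eH => <-.
Qed.

End GreedySpanners.

(** * The Moore bound *)

Section Moore.
Variables (X D : finType) (A : {set D}) (rev_dart : D -> D) (tl : D -> X).
Variable k : nat.
Hypothesis rev_dartK : involutive rev_dart.
Hypothesis rev_dartA : forall d, d \in A -> rev_dart d \in A.

Let hd d := tl (rev_dart d).

(** Only the reversal of the same dart is forbidden, so parallel darts count as different. Keeping
    darts abstract serves both the edges of [H] and the shifted edges between buckets of the
    tour. *)
Definition nonbacktracking : rel D :=
  fun d d' => (tl (rev_dart d) == tl d') && (d' != rev_dart d).

Hypothesis girth : forall d p, all (mem A) (d :: p) -> path nonbacktracking d p ->
  (size p < 2 * k)%N -> tl d != tl (rev_dart (last d p)).

Let inside (S : {set X}) := [set d in A | (tl d \in S) && (hd d \in S)].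
Let out S x := [set d in inside S | tl d == x].

(** In a smallest set that keeps the density, every node has large degree: deleting a node destroys
    only its outgoing darts and their reversals, and would otherwise preserve the density. *)
Lemma min_degree_subset q : (2 * q * #|X| < #|A|)%N ->
  exists S : {set X}, (exists x, x \in S) /\ forall x, x \in S -> (q < #|out S x|)%N.
Proof.
move=> qA; pose P (S : {set X}) := (2 * q * #|S| < #|inside S|)%N.
have PT : P [set: X].
  rewrite /P cardsT; apply: leq_trans qA _; apply: subset_leq_card.
  by apply/fintype.subsetP => d dA; rewrite !inE dA.
have [S PS Smin] := @arg_minnP _ [set: X] P (fun S : {set X} => #|S|) PT.
exists S; split.
  have /card_gt0P[d] : (0 < #|inside S|)%N by apply: leq_ltn_trans PS.
  by rewrite inE => /and3P[_ dS _]; exists (tl d).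
move=> x xS; have Sx : (#|S :\ x| < #|S|)%N by rewrite (cardsD1 x S) xS.
have : ~~ P (S :\ x) by apply/negP => /Smin; rewrite leqNgt Sx.
rewrite /P -leqNgt => Px.
have sub : inside S \subset inside (S :\ x) :|: (out S x :|: rev_dart @: out S x).
  apply/fintype.subsetP => d; rewrite inE => /and3P[dA dS dS'].
  rewrite !inE dA dS dS' /=; have [//|/= tx] := eqVneq (tl d) x; rewrite ?orbT //=.
  have [hx|//] := eqVneq (hd d) x; apply/imsetP; exists (rev_dart d).
    by rewrite !inE rev_dartA //= /hd rev_dartK -/(hd d) dS dS' hx /=.
  by rewrite rev_dartK.
have c1 := leq_trans (subset_leq_card sub) (leq_card_setU _ _).
have c2 := leq_trans c1 (leq_add (leqnn _) (leq_card_setU _ _)).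
have c3 := leq_imset_card rev_dart (out S x).
move: PS; rewrite /P (cardsD1 x S) xS.
by move: c2 c3 Px; clear;
  move: #|inside S| #|inside (S :\ x)| #|out S x| #|_ @: _| #|_ :\ _|; nia.
Qed.

(** The last darts of nonbacktracking walks of [j + 1] darts inside [S] from [x0]. *)
Let layer S x0 j := iter j
  (fun L : {set D} => [set d in inside S | [exists e in L, nonbacktracking e d]])
  (out S x0).

Lemma layer_walk S x0 j d : d \in layer S x0 j -> exists d0 p,
  [/\ tl d0 = x0, all (mem A) (d0 :: p), path nonbacktracking d0 p, last d0 p = d
    & size p = j].
Proof.
elim: j d => [|j IH] d /=.
  rewrite !inE => /andP[/andP[dA _] /eqP dx]; exists d, [::]; split=> //=.
  by rewrite dA.
rewrite inE => /andP[dS /existsP[e /andP[/IH[d0 [p [d0x pA pp pe <-]]] ed]]].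
exists d0, (rcons p d); rewrite size_rcons last_rcons rcons_path pp pe ed; split=> //.
by rewrite /= all_rcons; move: pA dS => /= /andP[-> ->]; rewrite inE => /andP[->].
Qed.

(** If two darts of the layer had the same head, following one walk out and the other back would
    close a nonbacktracking walk of [2 * (j + 1)] darts, at most [2 * k]. *)
Lemma layer_inj S x0 j : (j < k)%N -> {in layer S x0 j &, injective hd}.
Proof.
move=> jk d1 d2 /layer_walk[e1 [p1 [t1 A1 w1 l1 s1]]] /layer_walk[e2 [p2 [t2 A2 w2 l2
  s2]]] hh.
apply: contrapT => d12.
pose q := rev_dart d2 :: [seq rev_dart d | d <- rev (belast e2 p2)].
have lq : last e1 (p1 ++ q) = rev_dart e2.
  rewrite last_cat /q; case: (p2) l2 => [|y s] /= l2; first by rewrite l2.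
  by rewrite rev_cons map_rcons last_rcons.
suff : tl e1 != tl (rev_dart (last e1 (p1 ++ q))).
  by rewrite lq rev_dartK t1 t2 eqxx.
apply: girth.
- rewrite -cat_cons all_cat A1 /q /= rev_dartA; last first.
    by rewrite -l2; apply: (allP A2); rewrite mem_last.
  apply/allP => _ /mapP[d + ->]; rewrite mem_rev => /mem_belast dp.
  exact/rev_dartA/(allP A2).
- rewrite cat_path w1 l1 /=; apply/andP; split.
    by rewrite /nonbacktracking -/(hd d1) hh eqxx (inj_eq (can_inj rev_dartK)) eq_sym;
      apply/eqP.
  rewrite path_map -l2 rev_path; apply: sub_path w2 => z w /=.
  rewrite /nonbacktracking !rev_dartK => /andP[zw wz].
  by rewrite eq_sym zw eq_sym.
- rewrite size_cat /= size_map size_rev size_belast s1 s2; lia.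
Qed.

Lemma layer_card (S : {set X}) x0 q j : (forall x, x \in S -> (q < #|out S x|)%N) -> x0
  \in S ->
  (j < k)%N -> (q ^ j.+1 <= #|layer S x0 j|)%N.
Proof.
move=> deg x0S; elim: j => [|j IH] jk; first by rewrite expn1 ltnW // deg.
have {}IH := IH (ltnW jk).
have linS i d : d \in layer S x0 i -> d \in inside S.
  by case: i => [|i] /=; rewrite inE => /andP[].
(* Double counting of consecutive darts: each dart has at least [q] continuations, as only its
   reversal is lost from more than [q]; each continuation has one predecessor, by [layer_inj]. *)
apply: (@leq_trans (\sum_(d in layer S x0 j) \sum_(d' in inside S) nonbacktracking d d')).
  rewrite expnSr; apply: leq_trans (leq_mul IH (leqnn q)) _.
  rewrite -sum_nat_const; apply: leq_sum => d dL.
  have hS : hd d \in S by have := linS _ _ dL; rewrite inE => /and3P[].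
  have := deg _ hS; rewrite (cardsD1 (rev_dart d)) => dout.
  rewrite -(leq_add2l 1); apply: leq_trans dout (leq_add (leq_b1 _) _).
  rewrite -sum1_card [leqLHS]big_mkcond [leqRHS]big_mkcond /=.
  apply: leq_sum => d' _; rewrite /nonbacktracking -/(hd d) !inE.
  rewrite (eq_sym (hd d)).
  move: (tl d' == hd d) (d' == rev_dart d) (d' \in A) (tl d' \in S) (hd d' \in S).
  by do 5 case.
rewrite exchange_big -sum1_card [leqLHS]big_mkcond [leqRHS]big_mkcond.
apply: leq_sum => d' _ /=.
have -> : (d' \in layer S x0 j.+1) =
    (d' \in inside S) && [exists e in layer S x0 j, nonbacktracking e d'].
  by rewrite /= inE.
case: ifP => //= _.
have [/existsP[d /andP[dL dd]]|/existsPn no] := boolP [exists e in layer S x0 j,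
  nonbacktracking e d'].
  rewrite (bigD1 d) //= dd big1 ?addn0 // => e /andP[eL ed].
  apply/eqP; rewrite eqb0; apply: contra ed => ed'; apply/eqP.
  apply: (layer_inj (ltnW jk) eL dL).
  by move: dd ed' => /andP[/eqP + _] /andP[/eqP + _]; rewrite /hd => -> ->.
by rewrite big1 // => e eL; have := no e; rewrite eL /= => /negPf ->.
Qed.

Lemma moore_bound q : (0 < k)%N -> (2 * q * #|X| < #|A|)%N -> (q ^ k <= #|X|)%N.
Proof.
move=> k0 /min_degree_subset[S [[x0 x0S] deg]].
have kk : (k.-1 < k)%N by rewrite prednK.
have := layer_card deg x0S kk; rewrite prednK // => /leq_trans; apply.
by rewrite -(card_in_imset (layer_inj kk)) max_card.
Qed.

Lemma moore_bound_powR (R : realType) : (0 < k)%N ->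
  #|A|%:R <= 4 * #|X|%:R `^ (1 + 1 / k%:R) :> R.
Proof.
move=> k0; set N := #|X|.
have [N0|N0] := posnP N.
  have -> : #|A| = 0%N.
    apply/eqP; rewrite cards_eq0; apply/eqP/setP => d; rewrite inE.
    by have /card0_eq/(_ (tl d)) := N0.
  by rewrite mulr_ge0 ?powR_ge0.
have N0R : 0 < N%:R :> R by rewrite ltr0n.
have kR : 0 < k%:R :> R by rewrite ltr0n.
set r : R := N%:R `^ (1 / k%:R).
have r1 : 1 <= r.
  by rewrite -[leLHS](powRr0 (N%:R : R)); apply: ler_powR; rewrite ?ler1n // divr_ge0.
have -> : N%:R `^ (1 + 1 / k%:R) = N%:R * r :> R.
  rewrite powRD; first by rewrite powRr1.
  by rewrite implybE (gt_eqF N0R) orbT.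
(* The bound is applied with degree [q + 1], whose [k]-th power exceeds [N]. The constant 4 comes
   from [2 * (q + 1) <= 4 * r], as [q] and 1 are at most [r]. *)
have /andP[qr rq] := truncn_itv (le_trans ler01 r1); set q := Num.truncn r in qr rq.
have Aq : (#|A| <= 2 * q.+1 * N)%N.
  rewrite leqNgt; apply/negP => /(moore_bound k0); rewrite leqNgt => /negP; apply.
  rewrite -(ltr_nat R) natrX; have <- : r ^+ k = N%:R.
    rewrite -powR_mulrn ?(le_trans ler01) // /r -powRrM mul1r mulVf ?gt_eqF //.
    by rewrite powRr1 // ltW.
  by rewrite ltrXn2r ?(le_trans ler01) // -lt0n.
apply: (@le_trans _ _ (2 * q.+1 * N)%:R); first by rewrite ler_nat.
rewrite !natrM -addn1 natrD; nra.
Qed.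

End Moore.

(** * Critical graphs *)

Lemma not_uniq_map (S T : eqType) (f : S -> T) (s : seq S) : ~~ uniq [seq f x | x <- s] ->
  exists s1 x s2 y s3, s = s1 ++ x :: s2 ++ y :: s3 /\ f x = f y.
Proof.
elim: s => [|x s IH] //=; rewrite negb_and negbK => /orP[/mapP[y ys xy]|/IH].
  by case/splitPr: ys => s2 s3; exists [::], x, s2, y, s3.
by case=> s1 [y [s2 [z [s3 [-> yz]]]]]; exists (x :: s1), y, s2, z, s3.
Qed.

Lemma seq_argmax (R : realType) (T : eqType) (f : T -> R) (x0 : T) (s : seq T) :
  exists2 x, x \in x0 :: s & forall y, y \in x0 :: s -> f y <= f x.
Proof.
elim: s x0 => [|x s IH] x0.
  by exists x0; rewrite ?mem_head // => y; rewrite inE => /eqP->.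
have [m ms mmax] := IH x; have [x0m|mx0] := leP (f x0) (f m).
  exists m; first by rewrite inE ms orbT.
  by move=> y; rewrite inE => /orP[/eqP->|/mmax].
exists x0; rewrite ?mem_head // => y; rewrite inE => /orP[/eqP->//|/mmax/le_trans].
by apply; apply: ltW.
Qed.

(* A [dart] stands for an edge outside of the light connected subgraph [T],
   with a direction and possibly further data. Consecutive darts of a walk need
   not share a node: the gap between them is bridged by a walk in [T] that is
   short compared to the lengths of the two edges. *)
Section NoShortClosedWalks.
Variables (R : realType) (V : finType) (D : eqType) (tlv hdv : D -> V).
Variables (step : rel D) (A : pred D).
Variables (l : {set V} -> R) (H T : {set {set V}}) (t eta kappa : R) (k : nat).

Let edge d := [set tlv d; hdv d].

Hypothesis TH : T \subset H.
Hypothesis lH : nonneg_on l H.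
Hypothesis critH : critical t l H.
Hypothesis AH : forall d, A d -> edge d \in H.
Hypothesis AT : forall d, A d -> edge d \notin T.
Hypothesis eta0 : 0 <= eta.
Hypothesis step_hop : forall d d', A d -> A d' -> step d d' ->
  reach l T (hdv d) (tlv d') (eta * Num.max (l (edge d)) (l (edge d'))).
Hypothesis step_gap : forall d d', A d -> A d' -> step d d' ->
  reach l T (hdv d) (tlv d') kappa.
Hypothesis step_turn : forall d d', A d -> A d' -> step d d' ->
  tlv d' = hdv d -> hdv d' = tlv d -> False.
Hypothesis kappaA : forall d, A d -> 2 * kappa <= k%:R * eta * l (edge d).
Hypothesis slack : (2 * k%:R - 1) * (1 + eta) + k%:R * eta <= t.

Lemma darts_reach e f d p : e \notin T -> 0 <= f ->
  all A (d :: p) -> path step d p -> all (fun x => l (edge x) <= f) (d :: p) ->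
  all (fun x => edge x != e) p ->
  reach l (H :\ e) (hdv d) (hdv (last d p)) ((size p)%:R * ((1 + eta) * f)).
Proof.
move=> eT f0; elim: p d => [|x p IH] d /=; first by rewrite mul0r => *; apply: reach_refl.
move=> /and3P[dA xA pA] /andP[dx xp] /and3P[df xf pf] /andP[xe pe].
have := IH x; rewrite /= xA xf => /(_ pA xp pf pe).
move=> r; have -> : (size p).+1%:R * ((1 + eta) * f) =
    (eta * f + f) + (size p)%:R * ((1 + eta) * f) by rewrite -natr1; ring.
apply: reach_trans r; apply: (reach_trans (v := tlv x)).
  apply: reachS (reach_le _ (step_hop dA xA dx)).
    apply/fintype.subsetP => g gT; rewrite !inE (fintype.subsetP TH) // andbT.
    by apply: contraNneq eT => <-.
  by rewrite ler_wpM2l // ge_max df.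
by apply: reach_le xf _; apply: reach_edge; rewrite !inE -/(edge x) xe AH.
Qed.

Lemma darts_reach_tail e f d p : e \notin T -> 0 <= f ->
  all A (d :: p) -> path step d p -> all (fun x => l (edge x) <= f) (d :: p) ->
  all (fun x => edge x != e) (belast d p) ->
  reach l (H :\ e) (tlv d) (tlv (last d p)) ((size p)%:R * ((1 + eta) * f)).
Proof.
move=> eT f0; elim: p d => [|x p IH] d /=; first by rewrite mul0r => *; apply: reach_refl.
move=> /and3P[dA xA pA] /andP[dx xp] /and3P[df xf pf] /andP[de pe].
have := IH x; rewrite /= xA xf => /(_ pA xp pf pe).
move=> r; have -> : (size p).+1%:R * ((1 + eta) * f) =
    (f + eta * f) + (size p)%:R * ((1 + eta) * f) by rewrite -natr1; ring.
apply: reach_trans r; apply: (reach_trans (v := hdv d)).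
  by apply: reach_le df _; apply: reach_edge; rewrite !inE -/(edge d) de AH.
apply: reachS (reach_le _ (step_hop dA xA dx)).
  apply/fintype.subsetP => g gT; rewrite !inE (fintype.subsetP TH) // andbT.
  by apply: contraNneq eT => <-.
by rewrite ler_wpM2l // ge_max df.
Qed.

(** Induction on the length. If no edge repeats, the rest of the walk is a forbidden detour around
    its longest edge. An edge repeated in the same direction encloses a shorter closed walk. If the
    directions are opposite, both occurrences are stripped off, and two gaps close what lies
    between; hence the tolerance [2 * kappa]. *)
Lemma no_short_closed_walk d p : all A (d :: p) -> path step d p ->
  (size p < 2 * k)%N -> ~ reach l T (hdv (last d p)) (tlv d) (2 * kappa).
Proof.
have [n] := ubnP (size p); elim: n => // n IH in d p *; rewrite ltnS => pn pA pp pk.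
move: pA pp pn pk; set s := d :: p => pA pp pn pk close.
have [us|/not_uniq_map[s1 [x [s2 [y [s3 [sE xy]]]]]]] := boolP (uniq [seq edge x | x <-
  s]).
  have [m ms mmax] := seq_argmax (fun x => l (edge x)) d p.
  have mA : A m by apply: (allP pA).
  set e := edge m; set f := l e in mmax.
  have f0 : 0 <= f by apply/lH/AH.
  have smax : all (fun x => l (edge x) <= f) s by apply/allP.
  apply: (critH (AH mA)); apply: reach_sym.
  have eT : e \notin T := AT mA.
  have [p1 [p2 sE]] : exists p1 p2, s = p1 ++ m :: p2.
    exists (take (index m s) s), (drop (index m s).+1 s).
    by rewrite -drop_index // cat_take_drop.
  have ss : sorted step s by [].
  have [n1 n2] : all (fun x => edge x != e) p1 /\ all (fun x => edge x != e) p2.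
    move: us; rewrite sE map_cat cat_uniq /= negb_or.
    move=> /and4P[_ /andP[e1 _] e2 _]; split; apply/allP => x xp.
      by apply: contra e1 => /eqP xe; rewrite /= -/e -xe; apply: (map_f edge).
    by apply: contra e2 => /eqP xe; rewrite /= -/e -xe; apply: (map_f edge).
  have r2 : reach l (H :\ e) (hdv m) (hdv (last d p)) ((size p2)%:R * ((1 + eta) * f)).
    have -> : last d p = last m p2.
      by rewrite -[last d p]/(last d s) sE last_cat.
    move: pA ss smax; rewrite sE !all_cat => /andP[_ ?] /cat_sorted2[_ ?] /andP[_ ?].
    exact: darts_reach.
  have r1 : reach l (H :\ e) (tlv d) (tlv m) ((size p1)%:R * ((1 + eta) * f)).
    move: pA ss smax; rewrite sE; case: p1 sE n1 => [|x p1] [<-].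
      by move=> *; rewrite mul0r; apply: reach_refl.
    move=> _ n1; rewrite -cat_rcons /= all_cat => /andP[dA /andP[A1 _]].
    rewrite cat_path all_cat => /andP[w1 _] /andP[m0 /andP[m1 _]].
    have := @darts_reach_tail e f d (rcons p1 m); rewrite last_rcons size_rcons.
    by rewrite belast_rcons /= dA m0; apply.
  have TH' : T \subset H :\ e.
    apply/fintype.subsetP => g gT; rewrite !inE (fintype.subsetP TH) // andbT.
    by apply: contraNneq eT => <-.
  apply: reach_le (reach_trans r2 (reach_trans (reachS TH' close) r1)).
  (* At most [2 * k - 1] other edges, each with a gap, cost [(1 + eta) * f] apiece; the closing gap
     costs at most [k * eta * f]. By [slack] the total is at most [t * f]. *)
  have sz : (size p1)%:R + (size p2)%:R + 1 <= 2 * k%:R :> R.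
    rewrite -natrD natr1 -natrM ler_nat.
    have <- : size s = (size p1 + size p2).+1.
      by rewrite sE -(cat1s m) !size_cat (_ : size [:: m] = 1%N) // addnCA.
    exact: pk.
  have kf := kappaA mA; rewrite -/e -/f in kf.
  have X0 : 0 <= (1 + eta) * f by rewrite mulr_ge0 // addr_ge0.
  have := ler_wpM2r f0 slack.
  have : ((size p1)%:R + (size p2)%:R) * ((1 + eta) * f) <=
      (2 * k%:R - 1) * ((1 + eta) * f) by apply: ler_wpM2r => //; lra.
  rewrite -/(edge m) -/e -/f; lra.
have sA x' : x' \in s -> A x' by apply: (allP pA).
have : sorted step s by [].
rewrite sE => /cat_sorted2[_] /=; rewrite cat_path /= => /and3P[xs2 s2y _].
have xA : A x by apply: sA; rewrite sE mem_cat inE eqxx orbT.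
have yA : A y by apply: sA; rewrite sE !(mem_cat, inE) eqxx !orbT.
have s2A : all A s2.
  by apply/allP => z zs; apply: sA; rewrite sE !(mem_cat, inE) zs !orbT.
have s2s : (size s2 < size p)%N.
  have : size s = (size p).+1 by [].
  rewrite sE -(cat1s x) -(cat1s y) !size_cat (_ : size [:: x] = 1%N) //.
  rewrite (_ : size [:: y] = 1%N) //; clear; lia.
have lA : A (last x s2).
  by have := mem_last x s2; rewrite inE => /orP[/eqP->//|]; apply: (allP s2A).
have s2n : (size s2 < n)%N := leq_trans s2s pn.
have s2k := ltn_trans s2s pk.
have lT : nonneg_on l T by move=> e /(fintype.subsetP TH)/lH.
case: (eq_set2 xy) => -[tt hh].
  apply: (IH x s2) => //=; first by rewrite xA.
  rewrite tt; apply: reach_le (step_gap lA yA s2y).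
  have := reach_ge0 lT (step_gap lA yA s2y); lra.
(* With nothing in between, the walk turns back along the same edge, which [step_turn] excludes. *)
case: s2 xs2 s2y s2A s2s s2n s2k lA sE => [|z s2] /=.
  by move=> _ xy' *; apply: (step_turn xA yA xy').
case/andP=> xz zs2 s2y zs2A _ s2n s2k lA _; case/andP: (zs2A) => zA _.
apply: (IH z s2) => //; try exact: ltnW.
rewrite mulr2n mulrDl !mul1r; apply: reach_trans (step_gap lA yA s2y) _.
by rewrite -hh; apply: step_gap.
Qed.

End NoShortClosedWalks.

Section WeightOfCriticalGraphs.
Variables (R : realType) (V : finType) (l : {set V} -> R) (H : {set {set V}}).
Hypothesis HV : H \subset complete_edges V.
Hypothesis l0 : forall e, e \in H -> 0 < l e.

Let lH : nonneg_on l H. Proof. by move=> e /l0/ltW. Qed.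

Lemma edge_ends e : e \in H -> exists u v, e = [set u; v].
Proof.
move=> /(fintype.subsetP HV); rewrite inE => /cards2P[u [v [_ ->]]].
by exists u, v.
Qed.

(** The case without gaps: the tree is empty and [eta] and [kappa] vanish, so closed walks of darts
    are closed walks of [H]. *)
Lemma critical_size t k : (0 < k)%N -> critical t l H -> 2 * k%:R - 1 <= t ->
  #|H|%:R <= 4 * #|V|%:R `^ (1 + 1 / k%:R) :> R.
Proof.
move=> k0 critH tk.
pose rev_dart (d : V * V) := (d.2, d.1); pose tl (d : V * V) := d.1.
pose A := [set d : V * V | [set d.1; d.2] \in H].
have revK : involutive rev_dart by case.
have revA d : d \in A -> rev_dart d \in A by rewrite !inE finset.setUC.
have HA : (#|H| <= #|A|)%N.
  apply: leq_trans (leq_imset_card (fun d : V * V => [set d.1; d.2]) A).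
  apply: subset_leq_card; apply/fintype.subsetP => e eH.
  have [u [v euv]] := edge_ends eH; apply/imsetP; exists (u, v) => //.
  by rewrite inE /= -euv.
apply: (@le_trans _ _ (#|A|%:R)); first by rewrite ler_nat.
apply: (moore_bound_powR (tl := tl) revK revA _ R k0) => d p pA pp pk.
apply/eqP => /= dp.
apply: (@no_short_closed_walk _ _ _ (fun d => d.1) (fun d => d.2)
  (nonbacktracking rev_dart tl) (mem A) l H finset.set0 t 0 0 k
  _ lH critH _ _ (lexx 0) _ _ _ _ _ d p pA pp pk).
- by rewrite finset.sub0set.
- by move=> x; rewrite /= inE.
- by move=> x _; rewrite inE.
- by move=> x y _ _ /andP[/eqP/= -> _]; apply: reach_refl; rewrite mul0r.
- by move=> x y _ _ /andP[/eqP/= -> _]; apply: reach_refl.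
- move=> [x1 x2] [y1 y2] _ _ /andP[_ /eqP xy] /= e1 e2.
  by apply: xy; rewrite /rev_dart /= e1 e2.
- by move=> x _; rewrite !mulr0 mul0r.
- by rewrite addr0 mulr1 mulr0 addr0.
- have -> : (last d p).2 = d.1 := esym dp.
  by apply: reach_refl; rewrite mulr0.
Qed.

Variables (T : {set {set V}}) (pos : V -> R).
Hypothesis TH : T \subset H.
Hypothesis posP : forall u v,
    [/\ 0 <= pos u <= 2 * weight l T, reach l T u v `|pos u - pos v|
      & reach l T u v (weight l T)].

Let W := weight l T.

Lemma critical_edge_lt t e : critical t l H -> e \in H -> e \notin T -> t * l e < W.
Proof.
move=> critH eH eT; rewrite ltNge; apply/negP => Wt.
have [u [v euv]] := edge_ends eH; have [_ _ r] := posP u v.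
have uvH : [set u; v] \in H by rewrite -euv.
apply: (critH u v uvH); rewrite -euv.
apply: reachS (reach_le Wt r); apply/fintype.subsetP => g gT.
by rewrite !inE (fintype.subsetP TH) // andbT; apply: contraNneq eT => <-.
Qed.

Section Group.
Variables (t eps w : R) (k : nat).
Hypothesis critH : critical t l H.
Hypothesis eps0 : 0 < eps.
Hypothesis w0 : 0 < w.
Hypothesis k0 : (0 < k)%N.
Hypothesis tk : (1 + eps) * (2 * k%:R - 1) <= t.

Let G := [set e in H :\: T | w <= l e < w * k%:R].

(* The positions of the tour are cut into buckets of width [rho], and an edge
   [uv] of length about [m w] is replaced by the [m + 1] edges obtained by
   shifting the buckets of [u] and [v] simultaneously by [0, ..., m]. Shifts cost
   only a fraction of the length, so the resulting graph on the buckets has no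
   cycle of at most [2 k] edges. *)
Let rho := eps * w / 4.
Let bucket u := Num.truncn (pos u / rho).
Let N := (Num.truncn (2 * W / rho) + k).+1.
Let width e := Num.truncn (l e / w).
Let dart := (V * V * 'I_k)%type.
Let rev_dart (d : dart) : dart := (d.1.2, d.1.1, d.2).
Let tl (d : dart) : 'I_N := inord (bucket d.1.1 + d.2).
Let A : {set dart} :=
  [set d : dart | ([set d.1.1; d.1.2] \in G) && (d.2 <= width [set d.1.1; d.1.2])%N].

Let rho0 : 0 < rho. Proof. by rewrite divr_gt0 // mulr_gt0. Qed.

Lemma bucket_itv u : rho * (bucket u)%:R <= pos u < rho * ((bucket u)%:R + 1).
Proof.
have [/andP[p0 _] _ _] := posP u u.
have /truncn_itv/andP[] : 0 <= pos u / rho by rewrite divr_ge0 // ltW.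
rewrite -/(bucket u) -natr1 ler_pdivlMr // ltr_pdivrMr // => ? ?.
by apply/andP; split; rewrite mulrC.
Qed.

Lemma tlE u (s : 'I_k) : (bucket u + s < N)%N.
Proof.
rewrite ltnS leq_add ?(ltnW (ltn_ord s)) //; apply: le_truncn.
by apply: ler_wpM2r; [rewrite invr_ge0 ltW|have [/andP[]] := posP u u].
Qed.

Lemma width_itv d : d \in A -> rho * (d.2 : nat)%:R <= eps / 4 * l [set d.1.1; d.1.2].
Proof.
rewrite inE => /andP[]; set e := [set _; _]; rewrite inE => /andP[_ /andP[we _]] de.
have : (width e)%:R <= l e / w.
  have /truncn_itv/andP[] // : 0 <= l e / w.
  by rewrite divr_ge0 ?(ltW w0) ?(le_trans (ltW w0)).
move/(le_trans _) => /(_ (d.2 : nat)%:R); rewrite ler_nat => /(_ de).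
rewrite ler_pdivlMr // => dw.
have -> : rho * (d.2 : nat)%:R = eps / 4 * ((d.2 : nat)%:R * w) by rewrite /rho; field.
by rewrite ler_wpM2l // divr_ge0 // ltW.
Qed.

Lemma bucket_dist u v (s s' : 'I_k) : (bucket u + s = bucket v + s')%N ->
  `|pos u - pos v| <= rho * (maxn s s').+1%:R.
Proof.
move=> uv; have /andP[u1 u2] := bucket_itv u; have /andP[v1 v2] := bucket_itv v.
have uvR : (bucket u)%:R + (s : nat)%:R = (bucket v)%:R + (s' : nat)%:R :> R.
  by rewrite -!natrD uv.
have s1 : (s : nat)%:R <= (maxn s s')%:R :> R by rewrite ler_nat leq_maxl.
have s2 : (s' : nat)%:R <= (maxn s s')%:R :> R by rewrite ler_nat leq_maxr.
have s3 : 0 <= (s : nat)%:R :> R by [].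
have s4 : 0 <= (s' : nat)%:R :> R by [].
rewrite -natr1 ler_norml; apply/andP; split; nra.
Qed.

Lemma group_no_short_closed_walk d p : all (mem A) (d :: p) ->
  path (nonbacktracking rev_dart tl) d p -> (size p < 2 * k)%N ->
  tl d != tl (rev_dart (last d p)).
Proof.
have tl_inj u v (s s' : 'I_k) : inord (bucket u + s) = inord (bucket v + s') :> 'I_N ->
    (bucket u + s = bucket v + s')%N.
  by move=> /(congr1 val) /=; rewrite !inordK ?tlE.
have gap u v (s s' : 'I_k) : inord (bucket u + s) = inord (bucket v + s') :> 'I_N ->
    reach l T u v (k%:R * rho).
  move=> /tl_inj/bucket_dist dd; have [_ r _] := posP u v.
  apply: reach_le r; apply: le_trans dd _; rewrite mulrC ler_pM2r // ler_nat.
  by rewrite gtn_max !ltn_ord.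
move=> pA pp pk; apply/eqP => dp.
have Awl x : x \in A -> w <= l [set x.1.1; x.1.2].
  by rewrite inE => /andP[]; rewrite inE => /andP[_ /andP[]].
have AHT x : x \in A -> ([set x.1.1; x.1.2] \in H) /\ ([set x.1.1; x.1.2] \notin T).
  by rewrite inE => /andP[]; rewrite !inE => /andP[/andP[-> ->]].
have k1 : 1 <= k%:R :> R by rewrite ler1n.
(* A gap is at most one bucket width plus one width per shift, and either part is at most [eps / 4]
   times the longer edge; hence [eps / 2]. As shifts are below [k], every gap is also at most
   [k * rho]. *)
apply: (@no_short_closed_walk _ _ _ (fun d : dart => d.1.1) (fun d : dart => d.1.2)
  (nonbacktracking rev_dart tl) (mem A) l H T t (eps / 2) (k%:R * rho) k
  TH lH critH _ _ _ _ _ _ _ _ d p pA pp pk).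
- by move=> x /AHT[].
- by move=> x /AHT[].
- by rewrite divr_ge0 // ltW.
- move=> x y xA yA /andP[/eqP/= xy _]; have [_ r _] := posP x.1.2 y.1.1.
  apply: reach_le r; apply: le_trans (bucket_dist (tl_inj _ _ _ _ xy)) _.
  have wx := width_itv xA; have wy := width_itv yA.
  have lx := Awl _ xA; have ly := Awl _ yA.
  have M1 : l [set x.1.1; x.1.2] <= Num.max (l [set x.1.1; x.1.2]) (l [set y.1.1; y.1.2]).
    by rewrite le_max lexx.
  have M2 : l [set y.1.1; y.1.2] <= Num.max (l [set x.1.1; x.1.2]) (l [set y.1.1; y.1.2]).
    by rewrite le_max lexx orbT.
  set M := Num.max _ _ in M1 M2 *; rewrite -natr1 mulrDr mulr1.
  have rM : rho <= eps / 4 * M.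
    by rewrite /rho mulrAC ler_pM2l ?divr_gt0 //; apply: le_trans lx M1.
  have : rho * (maxn x.2 y.2)%:R <= eps / 4 * M.
    have e4 : 0 <= eps / 4 by rewrite divr_ge0 // ltW.
    by case: (leqP x.2 y.2) => _; [apply: le_trans wy _|apply: le_trans wx _];
      apply: ler_wpM2l.
  lra.
- by move=> x y xA yA /andP[/eqP/= /gap].
(* When the ends match exactly, equal shifted buckets force equal shifts, so the second dart would
   be the reversal of the first. *)
- move=> [[x1 x2] s] [[y1 y2] s'] _ _ /andP[/eqP + /eqP xy] /= e1 e2.
  rewrite /tl /= -e1 => /tl_inj/addnI/ord_inj ss; apply: xy.
  by rewrite /rev_dart /= e1 e2 ss.
- move=> x xA; have lx := Awl _ xA.
  have -> : 2 * (k%:R * rho) = k%:R * (eps / 2) * w by rewrite /rho; field.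
  by rewrite ler_wpM2l // mulr_ge0 // divr_ge0 // ltW.
- apply: le_trans _ tk.
  by have : 0 <= eps * (k%:R - 1) by [rewrite mulr_ge0 // ?(ltW eps0) // subr_ge0]; lra.
- apply: (@reach_le _ _ _ _ _ _ (k%:R * rho)).
    by rewrite mulr2n mulrDl mul1r lerDl mulr_ge0 // ltW.
  by apply: reach_sym; apply: gap dp.
Qed.

(** An edge has [width e + 1 > l e / w] shifts, so counting darts measures length. All these shifts
    are available in ['I_k] because [l e < w * k]. *)
Lemma group_darts : \sum_(e in G) l e <= w * #|A|%:R.
Proof.
pose B := [set x : {set V} * 'I_k | (x.1 \in G) && (x.2 <= width x.1)%N].
have BA : (#|B| <= #|A|)%N.
  apply: leq_trans (leq_imset_card (fun d : dart => ([set d.1.1; d.1.2], d.2)) A).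
  apply: subset_leq_card; apply/fintype.subsetP => -[e s]; rewrite inE /= => /andP[eG es].
  have eH : e \in H by move: eG; rewrite !inE => /andP[/andP[]].
  have [u [v euv]] := edge_ends eH; apply/imsetP; exists (u, v, s); last by rewrite euv.
  by rewrite inE /= -euv eG.
apply: (@le_trans _ _ (w * #|B|%:R)); last by rewrite ler_pM2l // ler_nat.
have -> : #|B| = (\sum_(e in G) #|[set s : 'I_k | (s <= width e)%N]|)%N.
  rewrite -sum1_card; under [RHS]eq_bigr do rewrite -sum1_card.
  rewrite pair_big_dep /=; apply: eq_bigl => -[e s]; by rewrite !inE.
rewrite natr_sum mulr_sumr; apply: ler_sum => e; rewrite inE => /andP[_ /andP[we ek]].
have lw0 : 0 <= l e / w by rewrite divr_ge0 ?(ltW w0) ?(le_trans (ltW w0)).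
have /andP[le1 le2] := truncn_itv lw0.
have wk : (width e < k)%N.
  by rewrite -(ltr_nat R); apply: le_lt_trans le1 _; rewrite ltr_pdivrMr // mulrC.
apply: (@le_trans _ _ (w * (width e).+1%:R)).
  by rewrite mulrC -ler_pdivrMr // ltW.
rewrite ler_pM2l // ler_nat.
have inj : injective (widen_ord wk) by move=> x y /(congr1 val) /= /ord_inj.
rewrite -[leqLHS]card_ord -(card_codom inj); apply: subset_leq_card.
by apply/fintype.subsetP => _ /codomP[x ->]; rewrite inE /= -ltnS ltn_ord.
Qed.

Lemma group_weight :
  \sum_(e in G) l e <= 400 * (w * (W / (eps * w)) `^ (1 + 1 / k%:R)).
Proof.
have [->|[e0 e0G]] := finset.set_0Vmem G.
  rewrite big_set0; apply: mulr_ge0; first exact: ler0n.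
  by apply: mulr_ge0; [exact: ltW|exact: powR_ge0].
have k1 : 1 <= k%:R :> R by rewrite ler1n.
(* Any edge of the group is longer than [w], up to equality, and shorter than [W / t]. This makes
   the number [k] of extra buckets negligible against [W / (eps * w)]. *)
have kW : eps * w * k%:R <= W.
  move: e0G; rewrite !inE => /andP[/andP[eT eH] /andP[we _]].
  have tl0 := critical_edge_lt critH eH eT.
  have : (1 + eps) * (2 * k%:R - 1) * w <= t * l e0.
    apply: ler_pM => //; last exact: ltW.
    by apply: mulr_ge0; [apply: addr_ge0 => //; exact: ltW|lra].
  move=> h; have : eps * w * k%:R <= (1 + eps) * (2 * k%:R - 1) * w.
    rewrite mulrAC ler_pM2r //.
    have : 0 <= eps * (k%:R - 1) by rewrite mulr_ge0 // ?(ltW eps0) // subr_ge0.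
    lra.
  lra.
set y := W / (eps * w).
have ew0 : 0 < eps * w by rewrite mulr_gt0.
have yk : k%:R <= y by rewrite /y ler_pdivlMr // mulrC.
(* The tour accounts for [8 * y] buckets, and [k] and 1 for at most [y] each. The factor 10 enters
   with an exponent of at most 2, whence 100 and finally [400 = 4 * 100]. *)
have Ny : N%:R <= 10 * y.
  have W0 : 0 <= 2 * W / rho.
    rewrite divr_ge0 ?(ltW rho0) // mulr_ge0 // (le_trans _ kW) //.
    by rewrite mulr_ge0 // ltW.
  have -> : N%:R = (Num.truncn (2 * W / rho))%:R + k%:R + 1 :> R.
    by rewrite -natrD natr1.
  have /andP[+ _] := truncn_itv W0.
  have -> : 2 * W / rho = 8 * y by rewrite /y /rho; field; rewrite !gt_eqF.
  by move=> ?; lra.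
apply: le_trans group_darts _; rewrite mulrCA ler_pM2l //.
have revK : involutive rev_dart by case=> [[]].
have revA d : d \in A -> rev_dart d \in A by rewrite !inE /= finset.setUC.
have := moore_bound_powR revK revA group_no_short_closed_walk R k0.
rewrite card_ord => /le_trans; apply.
have -> : 400 = 4 * 100 :> R by ring.
rewrite -mulrA ler_pM2l //.
have p0 : 0 <= 1 + 1 / k%:R :> R by rewrite addr_ge0 // divr_ge0.
have y0 : 0 <= y by lra.
apply: (@le_trans _ _ ((10 * y) `^ (1 + 1 / k%:R))).
  apply: ge0_ler_powR => //; rewrite nnegrE; first exact: ler0n.
  exact: le_trans (ler0n _ _) Ny.
rewrite powRM // ler_wpM2r ?powR_ge0 //.
have -> : 100 = 10 `^ 2 :> R by rewrite powR_mulrn //; ring.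
apply: ler_powR; first lra.
by rewrite -[2]/(1 + 1) lerD2l ler_pdivrMr ?mul1r // ltr0n.
Qed.

End Group.

End WeightOfCriticalGraphs.

(** * Summation over geometric scales of edge lengths *)

Section Scales.
Variables (R : realType) (V : finType) (l : {set V} -> R).
Implicit Types (H S T : {set {set V}}).

Lemma scales_sum S (a q : R) I : 0 <= a -> 1 <= q ->
  \sum_(e in S | a <= l e < a * q ^+ I) l e <=
  \sum_(i < I) \sum_(e in [set e in S | a * q ^+ i <= l e < a * q ^+ i * q]) l e.
Proof.
move=> a0 q1; elim: I => [|I IH].
  rewrite big_ord0 expr0 mulr1 big1 // => e /andP[_ /andP[ae ea]].
  by have := le_lt_trans ae ea; rewrite ltxx.
have aI : a <= a * q ^+ I by rewrite ler_peMr // exprn_ege1.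
have IS : a * q ^+ I <= a * q ^+ I * q by rewrite ler_peMr // (le_trans a0).
rewrite big_ord_recr /= exprSr mulrA (bigID (fun e => l e < a * q ^+ I)) /=.
apply: lerD.
  rewrite (eq_bigl (fun e => (e \in S) && (a <= l e < a * q ^+ I))) // => e.
  case: (e \in S) => //=; case: (a <= l e) => //=.
  by have [eI|] := ltP (l e) (a * q ^+ I); rewrite ?andbF // (lt_le_trans eI).
rewrite (eq_bigl (mem [set e in S | a * q ^+ I <= l e < a * q ^+ I * q])) // => e.
rewrite !inE; case: (e \in S) => //=; rewrite -leNgt.
by have [eI|] := leP (a * q ^+ I) (l e); rewrite ?andbF // (le_trans aI eI) andbT.
Qed.

Lemma lt_exp_truncn_ln (q x : R) : 1 < q -> 1 <= x ->
  x < q ^+ (Num.truncn (ln x / ln q)).+1.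
Proof.
move=> q1 x1; have x0 : 0 < x by lra.
have q0 : 0 < q by lra.
have lq : 0 < ln q by apply: ln_gt0.
rewrite -ltr_ln ?posrE ?exprn_gt0 // lnXn // -mulr_natr -ltr_pdivrMl // mulrC.
by have /truncn_itv/andP[] : 0 <= ln x / ln q by rewrite divr_ge0 ?ln_ge0 // ltW.
Qed.

(** With [x = ln k / k <= 1], the ratio of the series is [expR (- x) <= 1 / (1 + x)], which is at
    most [1 - x / 2]; so the sum is at most [2 / x]. *)
Lemma sum_root_le (k I : nat) : (2 <= k)%N ->
  \sum_(i < I) ((k%:R `^ (1 / k%:R))^-1) ^+ i <= 2 * k%:R / ln k%:R :> R.
Proof.
move=> k2; have k0 : 0 < k%:R :> R by rewrite ltr0n (leq_trans _ k2).
have lk : 0 < ln k%:R :> R by rewrite ln_gt0 // ltr1n.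
set x : R := ln k%:R / k%:R.
have x0 : 0 < x by rewrite divr_gt0.
have x1 : x <= 1 by rewrite /x ler_pdivrMr // mul1r ltW // ln_sublinear.
have yx : 1 + x <= k%:R `^ (1 / k%:R).
  by rewrite /powR gt_eqF // mul1r mulrC expR_ge1Dx.
set y := _ `^ _ in yx *; have y0 : 0 < y by lra.
have r0 : 0 <= y^-1 by rewrite invr_ge0 ltW.
have : x / 2 <= 1 - y^-1.
  have : y^-1 <= (1 + x)^-1 by rewrite lef_pV2 // posrE; lra.
  have : x / 2 <= 1 - (1 + x)^-1.
    rewrite -(@ler_pM2r _ (1 + x)); last lra.
    by rewrite mulrBl mulVf ?gt_eqF //; [nra|lra].
  lra.
have := subrX1 (y^-1) I; set s := \sum_(i < I) _.
have s0 : 0 <= s by apply: sumr_ge0 => i _; apply: exprn_ge0.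
have := exprn_ge0 I r0 => rI sE rx.
have : s * x <= 2 by nra.
by rewrite -ler_pdivlMr // /x invf_div mulrA.
Qed.

Variables (H T : {set {set V}}) (pos : V -> R).
Hypothesis HV : H \subset complete_edges V.
Hypothesis l0 : forall e, e \in H -> 0 < l e.
Hypothesis TH : T \subset H.
Hypothesis posP : forall u v,
    [/\ 0 <= pos u <= 2 * weight l T, reach l T u v `|pos u - pos v|
      & reach l T u v (weight l T)].

Let W := weight l T.
Let n : R := #|V|%:R.

Lemma critical_weight_gt0 t e : 0 < t -> critical t l H -> e \in H -> 0 < W.
Proof.
move=> t0 critH eH; have [eT|eT] := boolP (e \in T).
  apply: lt_le_trans (l0 eH) _; apply: weight_edge eT.
  by move=> f /(fintype.subsetP TH)/l0/ltW.
apply: lt_trans (critical_edge_lt HV TH posP critH eH eT).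
by rewrite mulr_gt0 // l0.
Qed.

Lemma weight_split (a : R) : weight l H =
  W + (\sum_(e in H :\: T | a <= l e) l e + \sum_(e in H :\: T | ~~ (a <= l e)) l e).
Proof.
rewrite /weight (big_setID T) /= (finset.setIidPr TH); congr (_ + _).
exact: bigID.
Qed.

Lemma light_edges_le (a : R) : 0 <= a ->
  \sum_(e in H :\: T | ~~ (a <= l e)) l e <= a * #|H|%:R.
Proof.
move=> a0; apply: (@le_trans _ _ (\sum_(e in H) a)); last first.
  by rewrite sumr_const mulr_natr.
rewrite [leLHS]big_mkcondr /= [leRHS](big_setID T) /= -[leLHS]add0r.
apply: lerD; first exact: sumr_ge0.
by apply: ler_sum => e _; case: ifP => //; rewrite -ltNge => /ltW.
Qed.

(** Edges shorter than [W / n] are paid for by their number, the others scale by scale through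
    [group_weight]; the scales grow by the factor [k]. *)
Lemma critical_weight t eps k : (2 <= k)%N -> 0 < eps ->
  (1 + eps) * (2 * k%:R - 1) <= t -> critical t l H ->
  weight l H <= 800 * (n `^ (1 / k%:R) *
    (1 + k%:R / (eps `^ (1 + 1 / k%:R) * ln k%:R))) * W.
Proof.
move=> k2 eps0 tk critH.
have lT : nonneg_on l T by move=> f /(fintype.subsetP TH)/l0/ltW.
have W0 : 0 <= W := weight_ge0 lT.
have k0 : (0 < k)%N := leq_trans (isT : (0 < 2)%N) k2.
have kR2 : 2 <= k%:R :> R by rewrite ler_nat.
have k1R : 1 <= k%:R :> R by rewrite ler1n.
have lk : 0 < ln k%:R :> R by rewrite ln_gt0 // ltr1n.
set M := n `^ _; set E := eps `^ _.
have M0 : 0 <= M := powR_ge0 _ _.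
have E0 : 0 < E := powR_gt0 _ eps0.
have [HE|[e0 e0H]] := finset.set_0Vmem H.
  have -> : weight l H = 0 by rewrite /weight HE big_set0.
  rewrite -!mulrA mulr_ge0 ?ler0n // mulr_ge0 // mulr_ge0 //.
  by rewrite addr_ge0 // divr_ge0 // ltW // mulr_gt0.
have t1 : 1 <= t.
  apply: le_trans tk; have : 0 <= eps * (2 * k%:R - 1) by rewrite mulr_ge0 ?ltW //; lra.
  lra.
have Wp : 0 < W := critical_weight_gt0 (lt_le_trans ltr01 t1) critH e0H.
have n1 : 1 <= n.
  rewrite ler1n; apply/card_gt0P; have [u [v _]] := edge_ends HV e0H.
  by exists u.
have n0 : 0 < n by lra.
have nk : n `^ (1 + 1 / k%:R) = n * M.
  by rewrite powRD ?powRr1 ?implybE ?(gt_eqF n0) ?orbT // ltW.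
have Ek : E = eps * eps `^ (1 / k%:R).
  by rewrite /E powRD ?powRr1 ?implybE ?(gt_eqF eps0) ?orbT // ltW.
have M1 : 1 <= M.
  by rewrite -[leLHS](powRr0 n); apply: ler_powR; rewrite ?divr_ge0.
pose a := W / n; have a0 : 0 < a by rewrite divr_gt0.
have light : \sum_(e in H :\: T | ~~ (a <= l e)) l e <= 4 * M * W.
  apply: le_trans (light_edges_le (ltW a0)) _.
  have tk2 : 2 * k%:R - 1 <= t.
    apply: le_trans tk; have : 0 <= eps * (2 * k%:R - 1) by rewrite mulr_ge0 ?ltW //; lra.
    lra.
  have := critical_size HV l0 k0 critH tk2; rewrite -/n nk => Hn.
  apply: le_trans (ler_wpM2l (ltW a0) Hn) _.
  rewrite /a (_ : W / n * (4 * (n * M)) = 4 * M * W) //; field; exact: lt0r_neq0.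
set r : R := (k%:R `^ (1 / k%:R))^-1.
have heavy : \sum_(e in H :\: T | a <= l e) l e <= 400 * (M / E) * (2 * k%:R / ln k%:R)
  * W.
  set I := (Num.truncn (ln n / ln (k%:R : R))).+1.
  have nI : n < k%:R ^+ I by apply: lt_exp_truncn_ln => //; lra.
  have -> : \sum_(e in H :\: T | a <= l e) l e =
      \sum_(e in H :\: T | a <= l e < a * k%:R ^+ I) l e.
    apply: eq_bigl => e; rewrite inE; case: (boolP (e \in T)) => //= eT.
    case: (boolP (e \in H)) => //= eH; case: (a <= l e) => //=.
    apply/esym; apply: (@lt_trans _ _ W).
      apply: le_lt_trans (critical_edge_lt HV TH posP critH eH eT).
      by rewrite ler_peMl // ltW // l0.
    by rewrite /a mulrAC ltr_pdivlMr // ltr_pM2l.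
  apply: le_trans (scales_sum _ _ (ltW a0) k1R) _.
  apply: (@le_trans _ _ (\sum_(i < I) 400 * (M / E) * W * r ^+ i)); last first.
    rewrite -mulr_sumr [leRHS]mulrAC; apply: ler_wpM2l; last exact: sum_root_le.
    apply: mulr_ge0; last exact: W0.
    by apply: mulr_ge0; [exact: ler0n|rewrite divr_ge0 // ltW].
  (* Here [w = k ^ i * W / n], so [z = W / (eps * w)] equals [n / (eps * k ^ i)]: its [k]-th root
     supplies the factor [r ^ i], and [w * z = W / eps]. *)
  apply: ler_sum => i _; set w := a * _.
  have ki : 0 < k%:R ^+ i :> R by rewrite exprn_gt0 // ltr0n.
  have w0 : 0 < w by rewrite mulr_gt0.
  apply: le_trans (group_weight HV l0 TH posP critH eps0 w0 k0 tk) _.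
  set y : R := k%:R `^ (1 / k%:R) in r *; set c : R := eps `^ (1 / k%:R) in Ek.
  have y0 : 0 < y by rewrite powR_gt0 // ltr0n.
  have c0 : 0 < c by rewrite powR_gt0.
  set z := W / _; have z0 : 0 < z by rewrite divr_gt0 // mulr_gt0.
  have zn : z * eps * k%:R ^+ i = n.
    by rewrite /z /w /a; field; rewrite !gt_eqF.
  have wz : w * z = W / eps by rewrite /z; field; rewrite !gt_eqF.
  move: z z0 zn wz => z z0 zn wz.
  have -> : z `^ (1 + 1 / k%:R) = z * z `^ (1 / k%:R).
    by rewrite powRD ?powRr1 ?implybE ?(gt_eqF z0) ?orbT // ltW.
  have <- : z `^ (1 / k%:R) * c * y ^+ i = M.
    rewrite /M -zn !powRM ?mulr_ge0 ?(ltW z0) ?(ltW eps0) ?(ltW ki) //.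
    by rewrite -/c -powR_mulrn ?(ltW y0) // /y powRAC powR_mulrn ?ler0n.
  rewrite le_eqVlt; apply/orP; left; apply/eqP.
  rewrite [w * _]mulrA wz /r exprVn Ek; field; rewrite ?gt_eqF ?exprn_gt0 //.
rewrite (weight_split a).
have -> : 800 * (M * (1 + k%:R / (E * ln k%:R))) * W =
  800 * M * W + 400 * (M / E) * (2 * k%:R / ln k%:R) * W.
  by field; rewrite !gt_eqF.
have : W <= M * W by rewrite ler_peMl.
have : 0 <= M * W by rewrite mulr_ge0.
rewrite -/W; lra.
Qed.

End Scales.

(** * Stars *)

(** Remove the interval that starts last: all others end before its start, which becomes the new
    bound [L]. *)
Lemma disjoint_intervals_sum (R : realType) (I : finType) (A : {set I}) (p g : I -> R) L :
  0 <= L -> (forall i, i \in A -> [/\ 0 < g i, 0 <= p i & p i + g i <= L]) ->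
  {in A &, forall i j, i != j -> p i <= p j -> p i + g i <= p j} ->
  \sum_(i in A) g i <= L.
Proof.
have [m] := ubnP #|A|; elim: m => // m IH in A L *; rewrite ltnS => Am L0 gL pA.
have [->|[i0 i0A]] := finset.set_0Vmem A; first by rewrite big_set0.
have [i /= iA imax] := @arg_maxP _ R _ i0 (fun i => i \in A) p i0A.
have [gi pi iL] := gL i iA; rewrite (big_setD1 i) //=.
suff : \sum_(j in A :\ i) g j <= p i by lra.
have pj j : j \in A :\ i -> p j + g j <= p i.
  by rewrite !inE => /andP[ji jA]; apply: pA => //; apply: imax.
apply: IH => // [||j1 j2]; last by rewrite !inE => /andP[_ +] /andP[_ +]; apply: pA.
  by move: Am; rewrite (cardsD1 i) iA.
by move=> j jA; split; [| |exact: pj]; move: jA; rewrite !inE => /andP[_ /gL[]].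
Qed.

Lemma sum_le_fibers (R : realType) (I J : finType) (A : {set I}) (B : {set J})
    (f : I -> J) (F : J -> R) : (forall j, j \in B -> 0 <= F j) ->
  (forall i, i \in A -> f i \in B) -> (forall j, j \in B -> exists2 i, i \in A & f i =
    j) ->
  \sum_(j in B) F j <= \sum_(i in A) F (f i).
Proof.
move=> F0 fAB fBA; rewrite [leRHS](partition_big f (mem B)) //=.
apply: ler_sum => j jB; have [i iA fij] := fBA j jB.
rewrite (bigD1 i) /=; last by apply/andP; split=> //; apply/eqP.
rewrite fij lerDl; apply: sumr_ge0 => i' /andP[/andP[i'A _] _].
exact/F0/fAB.
Qed.

Section Stars.
Variables (R : realType) (V : finType) (l : {set V} -> R).
Variables (H T : {set {set V}}) (pos : V -> R).
Hypothesis HV : H \subset complete_edges V.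
Hypothesis l0 : forall e, e \in H -> 0 < l e.
Hypothesis TH : T \subset H.
Hypothesis posP : forall u v,
    [/\ 0 <= pos u <= 2 * weight l T, reach l T u v `|pos u - pos v|
      & reach l T u v (weight l T)].

Let W := weight l T.

(* Two edges [vu] and [vu'] close a cycle through the tour, so the positions of
   [u] and [u'] differ by at least [t - 1] times the longer of the two. *)
Lemma star_weight t v : 1 < t -> critical t l H ->
  \sum_(u in [set u | [set v; u] \in H :\: T]) (t - 1) * l [set v; u] <= 3 * W.
Proof.
move=> t1 critH.
have W0 : 0 <= W by apply: weight_ge0 => f /(fintype.subsetP TH)/l0/ltW.
(* The intervals start at [pos u] and have length [(t - 1) * l [set v; u]]. They end before [3 * W],
   since positions are at most [2 * W] and [t * l] is below [W] outside the tree. *)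
apply: (disjoint_intervals_sum (p := pos)).
- by rewrite mulr_ge0.
- move=> u; rewrite !inE => /andP[eT eH]; have [/andP[p0 p1] _ _] := posP u u.
  have le := l0 eH; split => //; first by rewrite mulr_gt0 // subr_gt0.
  have := critical_edge_lt HV TH posP critH eH eT; rewrite -/W in p1 *; nra.
move=> u u'; rewrite !inE => /andP[eT eH] /andP[eT' eH'] uu' pp.
have ee' : [set v; u] != [set v; u'].
  apply/eqP => /eq_set2[[_ /eqP]|[vu' uv]]; first by rewrite (negPf uu').
  by move: uu'; rewrite uv vu' eqxx.
have [_ + _] := posP u u'; rewrite ler0_norm ?subr_le0 // opprB => r.
have sub e : e \notin T -> T \subset H :\ e.
  move=> eT0; apply/fintype.subsetP => g gT; rewrite !inE (fintype.subsetP TH) // andbT.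
  by apply: contraNneq eT0 => <-.
have crit1 : t * l [set v; u] < l [set v; u'] + (pos u' - pos u).
  rewrite ltNge; apply/negP => tle; apply: (critH v u eH).
  apply: reach_le tle _; apply: (reach_trans (v := u')).
    by apply: reach_edge; rewrite !inE eq_sym ee'.
  exact/reachS/reach_sym/r/sub.
have crit2 : t * l [set v; u'] < l [set v; u] + (pos u' - pos u).
  rewrite ltNge; apply/negP => tle; apply: (critH v u' eH').
  apply: reach_le tle _; apply: (reach_trans (v := u)).
    by apply: reach_edge; rewrite !inE ee'.
  exact: reachS (sub _ eT') r.
have := l0 eH; have := l0 eH'; case: (leP (l [set v; u]) (l [set v; u'])); nra.
Qed.

Lemma critical_weight_stars t : 1 < t -> critical t l H ->
  (t - 1) * (weight l H - W) <= 3 * #|V|%:R * W.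
Proof.
move=> t1 critH.
have -> : weight l H - W = \sum_(e in H :\: T) l e.
  by rewrite /weight (big_setID T) /= (finset.setIidPr TH) -/W addrAC subrr add0r.
pose A := [set d : V * V | [set d.1; d.2] \in H :\: T].
apply: (@le_trans _ _ (\sum_(d in A) (t - 1) * l [set d.1; d.2])).
  rewrite mulr_sumr.
  apply: (sum_le_fibers (f := fun d : V * V => [set d.1; d.2])
    (F := fun e => (t - 1) * l e)) => [e|d|e].
  - by rewrite inE => /andP[_ /l0 le]; rewrite mulr_ge0 // ltW // subr_gt0.
  - by rewrite inE.
  move=> eHT; have [u [v euv]] : exists u v, e = [set u; v].
    by apply: (edge_ends HV); move: eHT; rewrite inE => /andP[].
  by exists (u, v) => //; rewrite finset.in_set /= -euv.
have -> : \sum_(d in A) (t - 1) * l [set d.1; d.2] = \sum_(v in V)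
    \sum_(u in [set u | [set v; u] \in H :\: T]) (t - 1) * l [set v; u].
  rewrite pair_big_dep /=; apply: eq_bigl => d; by rewrite !inE.
apply: (@le_trans _ _ (\sum_(v in V) 3 * W)); first by apply: ler_sum => v _;
  apply: star_weight.
by rewrite sumr_const -[leLHS]mulr_natr [leLHS]mulrAC.
Qed.

End Stars.

(** * Euclidean space *)

Section EuclideanNorm.
Variables (R : realType) (d : nat).
Implicit Types x y : 'rV[R]_d.

Definition enorm x : R := Num.sqrt (\sum_(i < d) x ord0 i ^+ 2).

Lemma euclidean_distE x y : euclidean_dist x y = enorm (x - y).
Proof.
by rewrite /euclidean_dist /enorm; congr Num.sqrt; apply: eq_bigr => i _; rewrite !mxE.
Qed.

Let sum_sqr_ge0 x : 0 <= \sum_(i < d) x ord0 i ^+ 2.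
Proof. by apply: sumr_ge0 => i _; apply: sqr_ge0. Qed.

Lemma enorm_ge0 x : 0 <= enorm x. Proof. exact: sqrtr_ge0. Qed.

Lemma enorm_sqr x : enorm x ^+ 2 = \sum_(i < d) x ord0 i ^+ 2.
Proof. exact: sqr_sqrtr. Qed.

Lemma enormZ (c : R) x : 0 <= c -> enorm (c *: x) = c * enorm x.
Proof.
move=> c0; rewrite /enorm; under eq_bigr do rewrite mxE exprMn.
by rewrite -mulr_sumr sqrtrM ?sqr_ge0 // sqrtr_sqr ger0_norm.
Qed.

Lemma enormN x : enorm (- x) = enorm x.
Proof. by rewrite /enorm; congr Num.sqrt; apply: eq_bigr => i _; rewrite mxE sqrrN. Qed.

Lemma coord_le_enorm x i : `|x ord0 i| <= enorm x.
Proof.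
rewrite -(@ler_pXn2r _ 2) ?nnegrE ?enorm_ge0 // enorm_sqr real_normK ?num_real //.
by rewrite (bigD1 i) //= lerDl; apply: sumr_ge0 => j _; apply: sqr_ge0.
Qed.

Lemma enorm_le x (delta : R) : 0 <= delta -> (forall i, `|x ord0 i| <= delta) ->
  enorm x <= d%:R * delta.
Proof.
move=> delta0 xd; rewrite -(@ler_pXn2r _ 2) ?nnegrE ?enorm_ge0 ?mulr_ge0 // enorm_sqr.
apply: (@le_trans _ _ (\sum_(i < d) delta ^+ 2)).
  apply: ler_sum => i _; rewrite -(real_normK (num_real (x ord0 i))).
  by rewrite ler_pXn2r ?nnegrE.
rewrite sumr_const card_ord -[leLHS]mulr_natl exprMn ler_wpM2r ?sqr_ge0 //.
by rewrite -natrX ler_nat; case: (d) => // n; rewrite -mulnn leq_pmulr.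
Qed.

(** For nonzero norms [a] and [b], each product of coordinates obeys a mean inequality with weights
    [b / a] and [a / b]; these sum to [2 * a * b], as in Cauchy-Schwarz. *)
Lemma enormD x y : enorm (x + y) <= enorm x + enorm y.
Proof.
have [x0|x0] := leP (enorm x) 0.
  have {}x0 i : x ord0 i = 0.
    apply/eqP; rewrite -normr_le0; exact: le_trans (coord_le_enorm x i) x0.
  apply: (@le_trans _ _ (enorm y)); last by rewrite lerDr enorm_ge0.
  by rewrite /enorm; under eq_bigr do rewrite mxE x0 add0r.
have [y0|y0] := leP (enorm y) 0.
  have {}y0 i : y ord0 i = 0.
    apply/eqP; rewrite -normr_le0; exact: le_trans (coord_le_enorm y i) y0.
  apply: (@le_trans _ _ (enorm x)); last by rewrite lerDl enorm_ge0.
  by rewrite [leLHS]/enorm; under eq_bigr do rewrite mxE y0 addr0.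
rewrite -(@ler_pXn2r _ 2) ?nnegrE ?addr_ge0 ?enorm_ge0 // enorm_sqr.
set a := enorm x in x0 *; set b := enorm y in y0 *.
have xy i : 2 * (x ord0 i * y ord0 i) <= b / a * x ord0 i ^+ 2 + a / b * y ord0 i ^+ 2.
  rewrite -subr_ge0.
  have -> : b / a * x ord0 i ^+ 2 + a / b * y ord0 i ^+ 2 - 2 * (x ord0 i * y ord0 i)
    = a * b * (x ord0 i / a - y ord0 i / b) ^+ 2 by field; rewrite !gt_eqF.
  by rewrite mulr_ge0 ?sqr_ge0 // mulr_ge0 // ltW.
apply: (@le_trans _ _ (\sum_(i < d) (x ord0 i ^+ 2 + y ord0 i ^+ 2 +
    (b / a * x ord0 i ^+ 2 + a / b * y ord0 i ^+ 2)))).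
  by apply: ler_sum => i _; rewrite mxE; have := xy i; nra.
rewrite !big_split /= -!mulr_sumr -!enorm_sqr -/a -/b.
by rewrite le_eqVlt; apply/orP; left; apply/eqP; field; rewrite !gt_eqF.
Qed.

Variable delta : R.
Hypothesis delta0 : 0 < delta.

(** A grid of mesh [delta] on the cube of coordinates between -1 and 1, which contains all unit
    vectors; it stands in for a covering by narrow cones. *)
Definition direction_cell x : {ffun 'I_d -> 'I_(Num.truncn (2 / delta)).+1} :=
  [ffun i => inord (Num.truncn ((x ord0 i + 1) / delta))].

Lemma direction_cell_close x y : enorm x <= 1 -> enorm y <= 1 ->
  direction_cell x = direction_cell y -> enorm (x - y) <= d%:R * delta.
Proof.
have itv (z : 'rV[R]_d) (i : 'I_d) : enorm z <= 1 -> 0 <= (z ord0 i + 1) / delta <= 2 /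
  delta.
  move=> z1; have := le_trans (coord_le_enorm z i) z1.
  rewrite ler_norml => /andP[? ?]; apply/andP; split.
    by rewrite divr_ge0 ?(ltW delta0) //; lra.
  by rewrite ler_pM2r ?invr_gt0 //; lra.
move=> x1 y1 xy; apply: enorm_le; first exact: ltW.
move=> i; have /andP[xi0 xi2] := itv x i x1; have /andP[yi0 yi2] := itv y i y1.
move/ffunP/(_ i): xy; rewrite !ffunE => /(congr1 val) /=.
rewrite !inordK ?ltnS ?le_truncn // => txy.
have /andP[a1 a2] := truncn_itv xi0; have /andP[b1 b2] := truncn_itv yi0.
move: a1 a2 b1 b2; rewrite txy -natr1; set k : R := _%:R.
rewrite !ler_pdivlMr // !ltr_pdivrMr // !mxE => ? ? ? ?.
by rewrite ler_norml; apply/andP; split; nra.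
Qed.

End EuclideanNorm.

(** * Packing arguments for critical graphs in Euclidean space *)

Section EuclideanSpanners.
Variables (R : realType) (V : finType) (d : nat) (pt : V -> 'rV[R]_d).
Variables (l : {set V} -> R) (H T : {set {set V}}) (pos : V -> R) (alpha : R).
Let E := complete_edges V.
Hypothesis lpt : forall u v, l [set u; v] = enorm (pt u - pt v).
Hypothesis l0 : forall e, e \in E -> 0 < l e.
Hypothesis alpha1 : 1 < alpha.
Hypothesis HE : H \subset E.
Hypothesis critH : critical alpha l H.
Hypothesis spanH : locally_spanning alpha l E H.
Hypothesis TH : T \subset H.
Hypothesis posP : forall u v,
    [/\ 0 <= pos u <= 2 * weight l T, reach l T u v `|pos u - pos v|
      & reach l T u v (weight l T)].

Let W := weight l T.
(* [c] solves [1 + 2 c + 4 alpha c = alpha]. *)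
Let c : R := (alpha - 1) / (4 * alpha + 2).
(** Directions in a common cell differ by at most [d * delta <= c]; the added 1 keeps the mesh
    positive in dimension 0. *)
Let delta : R := c / (d%:R + 1).
Let cell_count : nat := #|{ffun 'I_d -> 'I_(Num.truncn (2 / delta)).+1}|.

Let c0 : 0 < c. Proof. by move: alpha1 => ?; rewrite divr_gt0 //; lra. Qed.

Let cE : c * (4 * alpha + 2) = alpha - 1.
Proof. by move: alpha1 => ?; rewrite /c divfK // gt_eqF //; lra. Qed.

Let c1 : 4 * c < 1. Proof. by move: alpha1 => ?; rewrite /c mulrA ltr_pdivrMr; lra. Qed.

Let delta0 : 0 < delta.
Proof. by rewrite divr_gt0 // ltr_wpDl. Qed.

Let delta_c : d%:R * delta <= c.
Proof.
rewrite /delta mulrCA ger_pMr // ler_pdivrMr ?mul1r ?lerDl //.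
Qed.

Let lH : nonneg_on l H. Proof. by move=> e /(fintype.subsetP HE)/l0/ltW. Qed.

Let direction (p : V * V) : 'rV[R]_d := (l [set p.1; p.2])^-1 *: (pt p.2 - pt p.1).
Let cell (p : V * V) := direction_cell delta (direction p).

Let edge_gt0 u v : [set u; v] \in H -> 0 < l [set u; v].
Proof. by move/(fintype.subsetP HE)/l0. Qed.

Let complete_edge u v : u != v -> [set u; v] \in E.
Proof. by move=> uv; rewrite inE cards2 uv. Qed.

Let direction_norm p : [set p.1; p.2] \in H -> enorm (direction p) = 1.
Proof.
move=> /edge_gt0 le; rewrite /direction enormZ ?invr_ge0 ?ltW //.
by rewrite -opprB enormN -lpt mulVf ?gt_eqF.
Qed.

Let directionE p : [set p.1; p.2] \in H ->
  pt p.2 - pt p.1 = l [set p.1; p.2] *: direction p.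
Proof. by move=> /edge_gt0 le; rewrite scalerA divff ?scale1r ?gt_eqF. Qed.

Lemma same_cell_close p q : [set p.1; p.2] \in H -> [set q.1; q.2] \in H ->
  cell p = cell q -> l [set p.1; p.2] <= l [set q.1; q.2] ->
  enorm (pt p.2 - pt q.2) <= enorm (pt p.1 - pt q.1) +
    (l [set p.1; p.2] * c + (l [set q.1; q.2] - l [set p.1; p.2])).
Proof.
move=> pH qH pq lpq; have lp := edge_gt0 pH.
have close : enorm (direction p - direction q) <= c.
  apply: le_trans delta_c; apply: (direction_cell_close delta0) => //.
    by rewrite direction_norm.
  by rewrite direction_norm.
(* The ends differ by the offset of the starts, the deviation of directions over the shorter length,
   and the excess of the longer edge. *)
have -> : pt p.2 - pt q.2 = (pt p.1 - pt q.1) +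
    (l [set p.1; p.2] *: (direction p - direction q) +
     - ((l [set q.1; q.2] - l [set p.1; p.2]) *: direction q)).
  rewrite scalerBr scalerBl -!directionE //.
  by apply/rowP => i; rewrite !mxE; ring.
apply: le_trans (enormD _ _) _; rewrite lerD2l.
apply: le_trans (enormD _ _) _; rewrite enormN (enormZ (_ - _) (ltW lp)).
rewrite (enormZ (direction q)) ?subr_ge0 //.
rewrite (direction_norm qH) mulr1 lerD2r ler_pM2l //.
Qed.

Lemma reach_enorm u v x : reach l H u v x -> enorm (pt u - pt v) <= x.
Proof.
pose P u v x := enorm (pt u - pt v) <= x.
apply: (@reach_rect _ _ l H P lH) => {u v x} [u x x0|u z v x uz zv|u v x x' xx' ux].
- rewrite /P subrr (_ : enorm 0 = 0) // /enorm.
  by under eq_bigr do rewrite mxE expr0n; rewrite big1 // sqrtr0.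
- rewrite /P (_ : pt u - pt v = (pt u - pt z) + (pt z - pt v)).
    by apply: le_trans (enormD _ _) _; rewrite lpt lerD2l.
  by rewrite addrA subrK.
- exact: le_trans ux xx'.
Qed.

(** Points closer than [l e] form an edge shorter than [e], so local spanning yields a walk that
    cannot use [e]. *)
Lemma close_reach u v x e : enorm (pt u - pt v) <= x -> x < l e ->
  reach l (H :\ e) u v (alpha * x).
Proof.
have a1 := alpha1; move=> uvx xe; have [->|uv] := eqVneq u v.
  by apply: reach_refl; rewrite mulr_ge0 // ?(le_trans (enorm_ge0 _) uvx) //; lra.
apply: (@reach_le _ _ _ _ _ _ (alpha * l [set u; v])).
  by rewrite ler_pM2l ?lpt //; lra.
apply: reachS (spanH (complete_edge uv)).
apply/fintype.subsetP => g; rewrite !inE => /andP[-> gl]; rewrite andbT.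
by apply: contraTneq gl => ->; rewrite -ltNge lpt (le_lt_trans uvx).
Qed.

(** With lengths [a <= b], going along the shorter edge and then from [v] to [v'] costs at most
    [a + alpha * (a * c + b - a)]. This is at most [alpha * b] whatever the ratio of [a] and [b], so
    the longer edge would not be critical. *)
Lemma star_cells_inj u v v' : [set u; v] \in H -> [set u; v'] \in H ->
  cell (u, v) = cell (u, v') -> v = v'.
Proof.
wlog lvv : v v' / l [set u; v] <= l [set u; v'].
  move=> th uv uv' vv'; have [le|le] := leP (l [set u; v]) (l [set u; v']).
    exact: th.
  by apply/esym/th => //; apply: ltW.
have a1 := alpha1; have c0' := c0; have c1' := c1; have cE' := cE.
move=> uv uv' vv'; apply: contrapT => /eqP nvv; apply: (critH uv').
have := same_cell_close (p := (u, v)) (q := (u, v')) uv uv' vv' lvv.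
have -> : enorm (pt u - pt u) = 0 by apply/eqP; rewrite eq_le enorm_ge0 reach_enorm //;
  apply: reach_refl.
rewrite add0r /= => close; have lv := edge_gt0 uv.
have lt : l [set u; v] * c + (l [set u; v'] - l [set u; v]) < l [set u; v'].
  have : l [set u; v] * c < l [set u; v] by rewrite gtr_pMr //; lra.
  lra.
apply: (reach_le _ (reach_trans (reach_edge _ _) (close_reach close lt))); last first.
  rewrite !inE uv andbT; apply/eqP => /eq_set2[[_ /eqP]|[uv2 vu]];
    first by rewrite (negPf nvv).
  by move: nvv; rewrite vu uv2 eqxx.
set a := l [set u; v]; set b := l [set u; v'].
have : 0 <= a * (alpha - 1 - alpha * c) by rewrite mulr_ge0 ?(ltW lv) //; lra.
lra.
Qed.

Lemma euclidean_size : (#|H| <= #|V| * cell_count)%N.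
Proof.
pose A := [set p : V * V | [set p.1; p.2] \in H].
have HA : (#|H| <= #|A|)%N.
  apply: leq_trans (leq_imset_card (fun p : V * V => [set p.1; p.2]) A).
  apply: subset_leq_card; apply/fintype.subsetP => e eH.
  have [u [v euv]] := edge_ends HE eH; apply/imsetP; exists (u, v) => //.
  by rewrite inE /= -euv.
apply: leq_trans HA _.
have inj : {in A &, injective (fun p : V * V => (p.1, cell p))}.
  move=> [u v] [u' v']; rewrite !inE /= => uv uv' [uu']; subst u' => cc.
  by rewrite (star_cells_inj uv uv' cc).
by rewrite -(card_in_imset inj) -card_prod max_card.
Qed.

Section Scale.
Variable r : R.
Hypothesis r0 : 0 < r.

Let S := [set e in H :\: T | r <= l e < r * (1 + c)].
Let bucket u := Num.truncn (pos u / (c * r)).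
Let N := (Num.truncn (2 * W / (c * r))).+1.
Let A := [set p : V * V | [set p.1; p.2] \in S].

Let cr0 : 0 < c * r. Proof. exact: mulr_gt0. Qed.

Lemma scale_bucket_lt u : (bucket u < N)%N.
Proof.
rewrite ltnS; apply: le_truncn.
by apply: ler_wpM2r; [rewrite invr_ge0 ltW|have [/andP[]] := posP u u].
Qed.

Lemma scale_bucket_dist u v : bucket u = bucket v -> `|pos u - pos v| <= c * r.
Proof.
have itv x : 0 <= pos x / (c * r).
  by have [/andP[p0 _] _ _] := posP x x; rewrite divr_ge0 // ltW.
move=> uv; have /truncn_itv/andP[] := itv u; have /truncn_itv/andP[] := itv v.
rewrite -!/(bucket _) uv -natr1; set k : R := _%:R.
rewrite !ler_pdivlMr // !ltr_pdivrMr // => ? ? ? ?.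
by rewrite ler_norml; apply/andP; split; nra.
Qed.

(** Otherwise the longer edge has a detour: along the tour to the start of the other edge, over that
    edge, and back by [close_reach]. The choice of [c] makes it short enough. *)
Lemma scale_inj :
  {in A &, injective (fun p : V * V => (inord (bucket p.1) : 'I_N, cell p))}.
Proof.
have a1 := alpha1; have c0' := c0; have c1' := c1; have cE' := cE; have r0' := r0.
suff main p q : p \in A -> q \in A -> bucket p.1 = bucket q.1 -> cell p = cell q ->
    l [set p.1; p.2] <= l [set q.1; q.2] -> p = q.
  move=> p q pA qA [/(congr1 val)/=]; rewrite !inordK ?scale_bucket_lt // => bpq cpq.
  have [le|le] := leP (l [set p.1; p.2]) (l [set q.1; q.2]); first exact: main.
  by apply/esym/main => //; apply: ltW.
rewrite !inE => /andP[/andP[pT pH] /andP[rp _]] /andP[/andP[qT qH] /andP[rq qr]] bpq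
  cpq lpq.
have posb := scale_bucket_dist bpq; have [_ rT _] := posP p.1 q.1.
have {}rT := reach_le posb rT.
have close1 := reach_enorm (reachS TH rT).
have close2 := same_cell_close pH qH cpq lpq.
set a := l [set p.1; p.2] in rp lpq close2; set b := l [set q.1; q.2] in rq qr lpq close2.
have crr : 4 * (c * r) < r by have := mulr_gt0 r0' (_ : 0 < 1 - 4 * c); nra.
have ac : a * c <= 2 * (c * r) by have : a <= 2 * r by [nra]; nra.
(* The starts contribute [c * r], the directions at most [2 * c * r] since [a <= 2 * r], and the
   difference of lengths at most [c * r]. *)
have close3 : enorm (pt p.2 - pt q.2) <= 4 * (c * r).
  by apply: le_trans close2 _; lra.
have [pq|pq] := eqVneq [set p.1; p.2] [set q.1; q.2].
  case: (eq_set2 pq) => -[e1 e2]; first by case: (p) (q) e1 e2 => [? ?] [? ?] /= -> ->.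
  (* The same edge in opposite directions would have its two ends in one bucket, closer than its
     length. *)
  by exfalso; move: close1; rewrite e1 -enormN opprB -lpt -/b; lra.
exfalso; apply: (critH qH); rewrite -/b; set e := [set q.1; q.2] in pq *.
have rT' : reach l (H :\ e) q.1 p.1 (c * r).
  apply/reach_sym/(reachS (finset.setSD _ TH)); apply: reach_avoid rT;
    last by rewrite -/b; lra.
  by move=> f /(fintype.subsetP TH)/lH.
have re : reach l (H :\ e) p.1 p.2 a by apply: reach_edge; rewrite !inE pq.
have r2 := close_reach close3 (lt_le_trans crr rq).
apply: reach_le (reach_trans (reach_trans rT' re) r2).
nra.
Qed.

Lemma scale_weight : \sum_(e in S) l e <= W * ((1 + c) * (2 / c + 1) * cell_count%:R).
Proof.
have c0' := c0; have r0' := r0.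
have W0 : 0 <= W by apply: weight_ge0 => f /(fintype.subsetP TH)/lH.
have [->|[e0 e0S]] := finset.set_0Vmem S.
  rewrite big_set0 !mulr_ge0 //; first lra.
  by rewrite addr_ge0 // divr_ge0 // ltW.
have rW : r <= W.
  move: e0S; rewrite !inE => /andP[/andP[eT eH] /andP[re _]].
  have := critical_edge_lt HE TH posP critH eH eT; rewrite -/W.
  by have := l0 (fintype.subsetP HE _ eH); have := alpha1; nra.
have SA : (#|S| <= N * cell_count)%N.
  have : (#|S| <= #|A|)%N.
    apply: leq_trans (leq_imset_card (fun p : V * V => [set p.1; p.2]) A).
    apply: subset_leq_card; apply/fintype.subsetP => e eS.
    have eH : e \in H by move: eS; rewrite !inE => /andP[/andP[]].
    have [u [v euv]] := edge_ends HE eH; apply/imsetP; exists (u, v) => //.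
    by rewrite finset.in_set /= -euv.
  move=> /leq_trans; apply; rewrite -(card_in_imset scale_inj).
  by rewrite -[X in (_ <= X * _)%N]card_ord -card_prod max_card.
apply: (@le_trans _ _ (\sum_(e in S) r * (1 + c))).
  by apply: ler_sum => e; rewrite !inE => /andP[_ /andP[_ /ltW]].
rewrite sumr_const -[leLHS]mulr_natr.
have NW : N%:R <= (2 / c + 1) * W / r :> R.
  have W1 : 0 <= 2 * W / (c * r) by apply: divr_ge0; [rewrite mulr_ge0|apply: ltW].
  have -> : N%:R = (Num.truncn (2 * W / (c * r)))%:R + 1 :> R by rewrite natr1.
  have /andP[+ _] := truncn_itv W1 => NW.
  have : 1 <= W / r by rewrite ler_pdivlMr // mul1r.
  have -> : (2 / c + 1) * W / r = 2 * W / (c * r) + W / r by field; rewrite !gt_eqF.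
  lra.
have cc : 0 <= cell_count%:R :> R by [].
have SR : #|S|%:R <= (2 / c + 1) * W / r * cell_count%:R :> R.
  apply: (@le_trans _ _ (N * cell_count)%:R); first by rewrite ler_nat.
  by rewrite natrM ler_wpM2r.
apply: (@le_trans _ _ (r * (1 + c) * ((2 / c + 1) * W / r * cell_count%:R))).
  by apply: ler_wpM2l => //; rewrite mulr_ge0 //; lra.
by rewrite le_eqVlt; apply/orP; left; apply/eqP; field; rewrite !gt_eqF.
Qed.

End Scale.

(** Edges below [W / n] are paid for by [euclidean_size]; logarithmically many scales of ratio
    [1 + c] cover the rest up to [W]. *)
Lemma euclidean_weight :
  weight l H <= W * (1 + cell_count%:R + (ln #|V|%:R / ln (1 + c) + 1) *
    ((1 + c) * (2 / c + 1) * cell_count%:R)).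
Proof.
have c0' := c0; have a1 := alpha1.
have q1 : 1 <= 1 + c by lra.
have q0 : 0 < 1 + c by lra.
have W0 : 0 <= W by apply: weight_ge0 => f /(fintype.subsetP TH)/lH.
set K : R := cell_count%:R; have K0 : 0 <= K by [].
set n : R := #|V|%:R; set Q := (1 + c) * _ * K.
have Q0 : 0 <= Q.
  rewrite /Q !mulr_ge0 //; first lra.
  by rewrite addr_ge0 // divr_ge0 // ltW.
have lq : 0 < ln (1 + c) by apply: ln_gt0; lra.
have [HE0|[e0 e0H]] := finset.set_0Vmem H.
  have -> : weight l H = 0 by rewrite /weight HE0 big_set0.
  rewrite mulr_ge0 // addr_ge0 ?addr_ge0 // mulr_ge0 // addr_ge0 // divr_ge0 ?(ltW lq) //.
  have [V0|V0] := posnP #|V|; first by rewrite /n V0 ln0.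
  by rewrite ln_ge0 // ler1n.
have lpos e : e \in H -> 0 < l e by move=> /(fintype.subsetP HE)/l0.
have Wp : 0 < W := critical_weight_gt0 HE lpos TH posP (lt_trans ltr01 a1) critH e0H.
have n1 : 1 <= n.
  rewrite ler1n; apply/card_gt0P; have [u [v _]] := edge_ends HE e0H.
  by exists u.
have n0 : 0 < n by lra.
pose a := W / n; have a0 : 0 < a by rewrite divr_gt0.
have light : \sum_(e in H :\: T | ~~ (a <= l e)) l e <= K * W.
  apply: le_trans (light_edges_le l H T (ltW a0)) _.
  have : #|H|%:R <= n * K by rewrite -natrM ler_nat euclidean_size.
  move=> /(ler_wpM2l (ltW a0))/le_trans; apply.
  by rewrite /a mulrA divfK ?gt_eqF // mulrC.
have heavy : \sum_(e in H :\: T | a <= l e) l e <= (ln n / ln (1 + c) + 1) * Q * W.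
  set I := (Num.truncn (ln n / ln (1 + c))).+1.
  have nI : n < (1 + c) ^+ I by apply: lt_exp_truncn_ln => //; lra.
  have -> : \sum_(e in H :\: T | a <= l e) l e =
      \sum_(e in H :\: T | a <= l e < a * (1 + c) ^+ I) l e.
    apply: eq_bigl => e; rewrite inE; case: (boolP (e \in T)) => //= eT.
    case: (boolP (e \in H)) => //= eH; case: (a <= l e) => //=.
    apply/esym; apply: (@lt_trans _ _ W).
      apply: le_lt_trans (critical_edge_lt HE TH posP critH eH eT).
      by rewrite ler_peMl // ltW // lpos.
    by rewrite /a mulrAC ltr_pdivlMr // ltr_pM2l.
  apply: le_trans (scales_sum l _ _ (ltW a0) q1) _.
  apply: (@le_trans _ _ (\sum_(i < I) W * Q)).
    by apply: ler_sum => i _; apply: scale_weight; rewrite mulr_gt0 // exprn_gt0.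
  rewrite sumr_const card_ord -[leLHS]mulr_natl -mulrA [W * Q]mulrC.
  apply: ler_wpM2r; first by rewrite mulr_ge0.
  have : 0 <= ln n / ln (1 + c) by apply: divr_ge0; [exact: ln_ge0|exact: ltW].
  have -> : I%:R = (Num.truncn (ln n / ln (1 + c)))%:R + 1 :> R by rewrite natr1.
  by move=> /truncn_itv/andP[+ _]; rewrite lerD2r.
by rewrite (weight_split l TH a) -/W; lra.
Qed.

End EuclideanSpanners.

(** * Lightness *)

Section GreedyLightness.
Variables (R : realType) (V : finType) (E : {set {set V}}) (l : {set V} -> R).
Variables (alpha : R) (H : {set {set V}}).
Let n : R := #|V|%:R.
Let W := mst_weight E l.

Lemma augmented_greedy_facts : 1 <= alpha -> spanner_instance E l ->
  augmented_greedy_spanner alpha E l H ->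
  [/\ is_spanner alpha E l H, H \subset complete_edges V,
      forall e, e \in H -> 0 < l e, critical alpha l H &
      exists (T : {set {set V}}) (pos : V -> R), [/\ T \subset H, weight l T = W &
        forall u v,
        [/\ 0 <= pos u <= 2 * weight l T, reach l T u v `|pos u - pos v|
          & reach l T u v (weight l T)]]].
Proof.
move=> a1 El HA; have [HM critH spanH] := augmented_greedy_critical a1 El HA.
have HE := fintype.subset_trans HM (metric_edges_sub El); have [EV cE l0] := El.
have l0H e : e \in H -> 0 < l e by move=> /(fintype.subsetP HE)/l0.
have [F Fmin] := minimum_connected_exists l cE.
have [T [TH cT wT]] := locally_spanning_connected El HE spanH Fmin.
have lT : nonneg_on l T by move=> e /(fintype.subsetP TH)/l0H/ltW.
have [pos posP] := tour_embedding cT lT.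
split=> //; first by apply: locally_spanning_is_spanner => //; lra.
  exact: fintype.subset_trans EV.
by exists T, pos; split=> //; rewrite wT /W (mst_weightE El Fmin).
Qed.

Lemma mst_weight_ge0 : spanner_instance E l -> 0 <= W.
Proof.
move=> El; have [_ cE _] := El; have [F Fmin] := minimum_connected_exists l cE.
rewrite /W (mst_weightE El Fmin); apply: weight_ge0 => e.
by case: Fmin => /fintype.subsetP FE _ _ /FE /(spanner_instance_nonneg El).
Qed.

(** Covers [y = 0], as for a one-node graph, where the quotient is 0. *)
Lemma ler_div_of_ler_mul (x y c : R) : 0 <= c -> 0 <= y -> x <= c * y -> x / y <= c.
Proof.
move=> c0; rewrite le_eqVlt => /orP[/eqP <-|y0] xcy; first by rewrite invr0 mulr0.
by rewrite ler_pdivrMr.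
Qed.

Lemma mst_le_opt : 0 <= alpha -> spanner_instance E l -> is_spanner alpha E l H ->
  W <= opt E l l (demand alpha E l).
Proof.
move=> a0 El Hsp; have [_ cE _] := El; have [F Fmin] := minimum_connected_exists l cE.
rewrite /W (mst_weightE El Fmin); case: Fmin => _ _ Fmin.
apply: lb_le_inf; first by exists (weight l H), H.
move=> _ [G /andP[GE /forallP dG] <-]; apply: Fmin => // u v.
have lE := spanner_instance_nonneg El; have [x dx] := dist_fin lE (cE u v).
move/forallP/(_ v): (dG u); rewrite /demand dx -EFinM => dGx.
apply: (reach_connect (c := alpha * x) (l := l)); apply/dist_le => //.
by move=> e /(fintype.subsetP GE)/lE.
Qed.

(** For stretch 1 every feasible graph contains all metric edges, so the output is optimal. The star
    bound degenerates in this case. *)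
Lemma metric_edges_weight_le_opt : spanner_instance E l -> H \subset metric_edges E l ->
  is_spanner 1 E l H -> weight l H <= opt E l l (demand 1 E l).
Proof.
move=> El HM Hsp; have lE := spanner_instance_nonneg El.
apply: lb_le_inf; first by exists (weight l H), H.
move=> _ [G /andP[GE /forallP dG] <-].
have lG : nonneg_on l G by move=> e /(fintype.subsetP GE)/lE.
apply: (weightS _ lG); apply: (fintype.subset_trans HM).
apply/fintype.subsetP => e /(metric_edgesP El)[eE eM].
have [EV _ _] := El; have [u [v euv]] := edge_ends EV eE.
apply: contrapT => /negP eG; apply: (eM u v euv).
have : reach l G u v (l e).
  apply/(dist_le _ _ _ lG); move/forallP/(_ v): (dG u) => /le_trans; apply.
  rewrite /demand mul1e; apply/(dist_le _ _ _ lE); rewrite euv; apply: reach_edge.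
  by rewrite -euv.
apply: reachS; apply/fintype.subsetP => f fG.
by rewrite !inE (fintype.subsetP GE) // andbT; apply: contraNneq eG => <-.
Qed.

Lemma card_ge2 : H \subset complete_edges V -> H != finset.set0 -> (2 <= #|V|)%N.
Proof.
move=> HV /set0Pn[e /(fintype.subsetP HV)]; rewrite inE => /eqP e2.
by apply: leq_trans (max_card (mem e)); rewrite e2.
Qed.

Lemma lightness_ln_bound : 1 <= alpha -> spanner_instance E l ->
  augmented_greedy_spanner alpha E l H ->
  let C1 := 4 * expR 8 `^ (1 + 1 / 1%:R) in let C2 := 800 * expR 6 * (1 + (ln 2)^-1) in
  (ln n <= alpha -> weight l H <= (C1 / ln 2 + C2) * ln n * W) /\
  (ln n ^+ 2 <= alpha -> weight l H <= (C1 + C2) * W).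
Proof.
move=> a1 El HA C1 C2; have [_ HV l0 critH [T [pos [TH wT posP]]]] :=
  augmented_greedy_facts a1 El HA.
have W0 := mst_weight_ge0 El; have ln2 : 0 < ln (2 : R) by rewrite ln_gt0 // ltr1n.
have C10 : 0 <= C1 by rewrite /C1 mulr_ge0 // powR_ge0.
have C20 : 0 <= C2.
  apply: mulr_ge0; last by rewrite addr_ge0 // invr_ge0 ltW.
  by apply: mulr_ge0; [exact: ler0n|exact: expR_ge0].
have ln0 : 0 <= ln n.
  have [V0|V0] := posnP #|V|; first by rewrite /n V0 ln0.
  by rewrite ln_ge0 // ler1n.
have C12 : 0 <= C1 / ln 2 by rewrite divr_ge0 // ltW.
have [HE|HE] := eqVneq H finset.set0.
  by rewrite /weight HE big_set0; split=> _; rewrite mulr_ge0 // ?mulr_ge0 ?addr_ge0.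
have n2 : 2 <= n by rewrite ler_nat; apply: card_ge2.
have n0 : 0 < n by lra.
have ln2n : ln 2 <= ln n by rewrite ler_ln ?posrE.
have nE : n = expR (ln n) by rewrite lnK.
(* For [n] below [expR 8] the number of edges is bounded by the constant [C1], and each edge weighs
   at most [W]. Otherwise [k], the integer part of [L / 4], is at least 2. *)
set L := ln n in ln0 ln2n nE *; have [L8|L8] := ltP L 8.
  have wH : weight l H <= C1 * W.
    have size1 : #|H|%:R <= C1.
      have t1 : 2 * 1%:R - 1 <= alpha by lra.
      apply: le_trans (critical_size HV l0 (ltn0Sn 0) critH t1) _.
      rewrite /C1 ler_pM2l //; apply: ge0_ler_powR; rewrite ?nnegrE ?expR_ge0 //.
      by rewrite -/n nE ler_expR ltW.
    apply: le_trans (ler_wpM2r W0 size1).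
    rewrite mulr_natl -sumr_const; apply: ler_sum => e eH; rewrite -wT.
    have [eT|eT] := boolP (e \in T).
      by apply: weight_edge eT => f /(fintype.subsetP TH)/l0/ltW.
    apply: le_trans (ltW (critical_edge_lt HV TH posP critH eH eT)).
    by rewrite ler_peMl // ltW // l0.
  have C2W : 0 <= C2 * W by rewrite mulr_ge0.
  split=> _; last by rewrite mulrDl; lra.
  apply: le_trans wH _; apply: ler_wpM2r => //.
  have : C1 <= C1 / ln 2 * L by rewrite mulrAC ler_pdivlMr // ler_wpM2l.
  have : 0 <= C2 * L by rewrite mulr_ge0.
  by rewrite [(C1 / ln 2 + C2) * L]mulrDl; lra.
have L40 : 0 <= L / 4 by lra.
have /andP[k1 k2] := truncn_itv L40; set k := Num.truncn (L / 4) in k1 k2.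
have {}k2 : L / 4 < k%:R + 1 by rewrite natr1.
have kR : 1 < k%:R :> R by lra.
have k2' : (2 <= k)%N by rewrite -(ltr_nat R).
have kR2 : 2 <= k%:R :> R by rewrite ler_nat.
have k0 : 0 < k%:R :> R by lra.
(* Because [L < 4 * (k + 1) <= 6 * k]. *)
have nk : n `^ (1 / k%:R) <= expR 6.
  rewrite /powR gt_eqF // ler_expR -/L mul1r mulrC ler_pdivrMr //; lra.
have lnk : ln 2 <= ln (k%:R : R) by rewrite ler_ln ?posrE // ler_nat.
have lnk0 : 0 < ln (k%:R : R) by lra.
have C2E x y : 0 <= x -> x <= y -> 800 * (n `^ (1 / k%:R) * x) * W <= 800 * expR 6 * y
  * W.
  move=> x0 xy; rewrite -[800 * expR 6 * y]mulrA.
  apply: (ler_wpM2r W0); apply: ler_wpM2l; first exact: ler0n.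
  exact: ler_pM (powR_ge0 _ _) x0 nk xy.
have kln : k%:R / ln k%:R <= L / 4 / ln 2 :> R.
  by apply: ler_pM => //; [rewrite invr_ge0 ltW|rewrite lef_pV2 ?posrE].
split=> La.
  (* The slack is [eps = 1], and the term [k / ln k] is of order at most [L]. *)
  have tk : (1 + 1) * (2 * k%:R - 1) <= alpha by lra.
  have := critical_weight HV l0 TH posP k2' ltr01 tk critH.
  rewrite powR1 (mul1r (ln _)) wT -/n => /le_trans; apply.
  apply: le_trans (C2E _ (L * (1 + (ln 2)^-1)) _ _) _.
  - by rewrite addr_ge0 // divr_ge0 // ltW.
  - have : L / 4 / ln 2 <= L / ln 2 by rewrite ler_pM2r ?invr_gt0 //; lra.
    rewrite mulrDr mulr1; lra.
  apply: ler_wpM2r => //; rewrite mulrCA mulrC [leLHS]mulrC /C2.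
  have : 0 <= C1 / ln 2 * L by rewrite mulr_ge0.
  by rewrite [(_ + _) * L]mulrDl; lra.
(* The larger stretch allows [eps = L - 1], which cancels the factor [k <= L / 4]. *)
have eps0 : 0 < L - 1 by lra.
have tk : (1 + (L - 1)) * (2 * k%:R - 1) <= alpha.
  apply: le_trans La; rewrite addrC subrK expr2; apply: ler_wpM2l => //; lra.
have := critical_weight HV l0 TH posP k2' eps0 tk critH.
rewrite wT -/n => /le_trans; apply.
have epsE : L - 1 <= (L - 1) `^ (1 + 1 / k%:R).
  by apply: le1r_powR; [lra|rewrite lerDl divr_ge0].
set eps := _ `^ (1 + _) in epsE *.
apply: le_trans (C2E _ (1 + (ln 2)^-1) _ _) _.
- by rewrite addr_ge0 // divr_ge0 // mulr_ge0 //; lra.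
- rewrite lerD2l invfM mulrCA -[leRHS]mul1r.
  apply: (@le_trans _ _ (eps^-1 * (L / 4 / ln 2))).
    by apply: ler_wpM2l => //; rewrite invr_ge0; lra.
  rewrite mulrA ler_wpM2r ?invr_ge0 ?(ltW ln2) //.
  by rewrite mulrC ler_pdivrMr ?mul1r; lra.
by rewrite -/C2 ler_wpM2r // lerDr.
Qed.

End GreedyLightness.

Lemma euclidean_greedy (R : realType) (d : nat) (alpha : R) : 1 < alpha ->
  exists C : R, 0 <= C /\ forall (V : finType) (E : {set {set V}}) (l : {set V} -> R)
      (H : {set {set V}}),
    geometric_instance d E l -> augmented_greedy_spanner alpha E l H ->
    weight l H <= C * ln #|V|%:R * mst_weight E l /\ #|H|%:R <= C * #|V|%:R.
Proof.
move=> a1; pose c : R := (alpha - 1) / (4 * alpha + 2).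
pose K : nat := #|{ffun 'I_d -> 'I_(Num.truncn (2 / (c / (d%:R + 1)))).+1}|.
pose Q : R := (1 + c) * (2 / c + 1) * K%:R.
have c0 : 0 < c by rewrite divr_gt0 //; lra.
have ln2 : 0 < ln (2 : R) by rewrite ln_gt0 // ltr1n.
have lnc : 0 < ln (1 + c) by rewrite ln_gt0 //; lra.
have K0 : 0 <= K%:R :> R by [].
have Q0 : 0 <= Q.
  apply: mulr_ge0 => //; apply: mulr_ge0; first exact: addr_ge0 ler01 (ltW c0).
  by apply: addr_ge0 => //; apply: divr_ge0 => //; apply: ltW.
(* A nonempty [H] forces at least two nodes, so constant terms are absorbed into the logarithm at
   the price of [1 / ln 2]. *)
pose C : R := (1 + K%:R + Q) / ln 2 + Q / ln (1 + c).
have C0 : 0 <= C by rewrite addr_ge0 // divr_ge0 ?addr_ge0 // ltW.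
exists (K%:R + C); split; first exact: addr_ge0.
move=> V E l H [El EV [pt lpt]] HA; subst E.
have a1' := ltW a1; have [_ _ spanH] := augmented_greedy_critical a1' El HA.
have [_ HE _ critH [T [pos [TH wT posP]]]] := augmented_greedy_facts a1' El HA.
have [_ _ l0] := El.
have lpt' u v : l [set u; v] = enorm (pt u - pt v) by rewrite lpt euclidean_distE.
split; last first.
  have size : (#|H| <= #|V| * K)%N := euclidean_size lpt' l0 a1 HE critH spanH.
  apply: (@le_trans _ _ (K%:R * #|V|%:R)).
    by rewrite -natrM ler_nat mulnC.
  by rewrite mulrDl lerDl mulr_ge0.
have W0 := mst_weight_ge0 El; rewrite -wT in W0 *.
set L := ln _; have [HE0|HE0] := eqVneq H finset.set0.
  rewrite /weight HE0 big_set0; apply: mulr_ge0 => //; apply: mulr_ge0.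
    exact: addr_ge0.
  rewrite /L; have [->|V0] := posnP #|V|; first by rewrite ln0.
  by rewrite ln_ge0 // ler1n.
have n2 : 2 <= #|V|%:R :> R by rewrite ler_nat; apply: card_ge2 HE0.
have L2 : ln 2 <= L by rewrite ler_ln ?posrE //; lra.
have : weight l H <= weight l T * (1 + K%:R + (L / ln (1 + c) + 1) * Q) :=
  euclidean_weight lpt' l0 a1 HE critH spanH TH posP.
move=> /le_trans; apply; rewrite mulrC; apply: ler_wpM2r => //.
have : (1 + K%:R + Q) <= (1 + K%:R + Q) / ln 2 * L.
  by rewrite mulrAC ler_pdivlMr // ler_wpM2l // !addr_ge0.
have : 0 <= K%:R * L by rewrite mulr_ge0 // (le_trans (ltW ln2)).
rewrite mulrDl /C mulrDl (mulrAC Q) [_ * Q]mulrDl (mulrAC L) mul1r (mulrC L Q); lra.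
Qed.

Theorem corollary7 (R : realType) :
  (exists C : R,
    forall (k : nat) (V : finType) (E : {set {set V}}) (l : {set V} -> R)
           (H : {set {set V}}),
      (1 <= k)%N -> spanner_instance E l ->
      augmented_greedy_spanner (2 * k%:R - 1) E l H ->
      [/\ is_spanner (2 * k%:R - 1) E l H,
          (2 <= k <= #|V|)%N -> lightness E l H <= C * (#|V|%:R / k%:R),
          (k <= #|V|)%N ->
            weight_ratio (2 * k%:R - 1) E l H <= C * (#|V|%:R / k%:R)
        & #|H|%:R <= C * #|V|%:R `^ (1 + 1 / k%:R)])
  /\
  (forall (d : nat) (alpha : R), 1 < alpha ->
    exists C : R,
      forall (V : finType) (E : {set {set V}}) (l : {set V} -> R)
             (H : {set {set V}}),
        geometric_instance d E l ->
        augmented_greedy_spanner alpha E l H ->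
        [/\ is_spanner alpha E l H,
            lightness E l H <= C * ln #|V|%:R
          & #|H|%:R <= C * #|V|%:R])
  /\
  (exists C : R,
    forall (V : finType) (E : {set {set V}}) (l : {set V} -> R) (alpha : R)
           (H : {set {set V}}),
      1 <= alpha -> spanner_instance E l ->
      augmented_greedy_spanner alpha E l H ->
      [/\ is_spanner alpha E l H,
          ln #|V|%:R <= alpha -> lightness E l H <= C * ln #|V|%:R
        & ln #|V|%:R ^+ 2 <= alpha -> lightness E l H <= C])
  /\
  (exists C : R,
    forall (k : nat) (eps : R) (V : finType) (E : {set {set V}})
           (l : {set V} -> R) (H : {set {set V}}),
      (1 <= k)%N -> 0 < eps -> spanner_instance E l ->
      augmented_greedy_spanner ((1 + eps) * (2 * k%:R - 1)) E l H ->
      is_spanner ((1 + eps) * (2 * k%:R - 1)) E l H /\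
      ((2 <= k)%N ->
        lightness E l H <=
          C * (#|V|%:R `^ (1 / k%:R) *
               (1 + k%:R / (eps `^ (1 + 1 / k%:R) * ln k%:R))))).
Proof.
split.
  exists 4 => k V E l H k1 El HA.
  have kR : 1 <= k%:R :> R by rewrite ler1n.
  have a1 : 1 <= 2 * k%:R - 1 :> R by lra.
  have [Hsp HV l0 critH [T [pos [TH wT posP]]]] := augmented_greedy_facts a1 El HA.
  have [HM _ _] := augmented_greedy_critical a1 El HA.
  have W0 := mst_weight_ge0 El.
  have nk0 : 0 <= 4 * (#|V|%:R / k%:R) :> R by rewrite mulr_ge0 // divr_ge0.
  have wH : (2 <= k <= #|V|)%N -> weight l H <= 4 * (#|V|%:R / k%:R) * mst_weight E l.
    case/andP=> k2 kn; have k2R : 2 <= k%:R :> R by rewrite ler_nat.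
    have t1 : 1 < 2 * k%:R - 1 :> R by lra.
    (* Since [2 * k - 2 >= k], the edges outside the tree weigh at most [3 * n * W / k]; the tree
       adds [W <= n * W / k], for a total factor of 4. *)
    have := critical_weight_stars HV l0 TH posP t1 critH; rewrite wT => star.
    have knR : k%:R <= #|V|%:R :> R by rewrite ler_nat.
    set W := mst_weight E l in W0 star *; have [wW|wW] := leP (weight l H) W.
      apply: le_trans wW _; rewrite ler_peMl //.
      by rewrite mulrA ler_pdivlMr; lra.
    rewrite mulrA mulrAC ler_pdivlMr; last lra.
    have : k%:R * (weight l H - W) <= (2 * k%:R - 1 - 1) * (weight l H - W).
      by apply: ler_wpM2r; lra.
    have : k%:R * W <= #|V|%:R * W by apply: ler_wpM2r.
    lra.
  split=> //.
  - by move=> kn; apply: ler_div_of_ler_mul => //; apply: wH.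
  - move=> kn; have Wopt := mst_le_opt (le_trans ler01 a1) El Hsp.
    have opt0 := le_trans W0 Wopt.
    have [k2|k2] := leqP 2 k.
      apply: ler_div_of_ler_mul => //; apply: le_trans (wH _) _; first by rewrite k2.
      exact: ler_wpM2l.
    have kE : k = 1%N by apply/eqP; rewrite eqn_leq k1 -ltnS k2.
    subst k; have aE : 2 * 1%:R - 1 = 1 :> R by lra.
    rewrite /weight_ratio; move: Hsp opt0; rewrite aE => Hsp opt0.
    apply: ler_div_of_ler_mul => //.
    apply: le_trans (metric_edges_weight_le_opt El HM Hsp) _; rewrite ler_peMl //.
    have : 1 <= #|V|%:R :> R by rewrite ler1n.
    by rewrite divr1; lra.
  - exact: (critical_size HV l0 k1 critH).
split.
  move=> d alpha a1; have [C [C0 geo]] := euclidean_greedy d a1.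
  exists C => V E l H El HA; have [wH sH] := geo V E l H El HA.
  have [El' _ _] := El; have W0 := mst_weight_ge0 El'.
  have [Hsp _ _ _ _] := augmented_greedy_facts (ltW a1) El' HA.
  split=> //; apply: ler_div_of_ler_mul => //; apply: mulr_ge0 => //.
  have [->|V0] := posnP #|V|; first by rewrite ln0.
  by rewrite ln_ge0 // ler1n.
split.
  have ln2 : 0 < ln (2 : R) by rewrite ln_gt0 // ltr1n.
  pose C1 : R := 4 * expR 8 `^ (1 + 1 / 1%:R).
  pose C2 : R := 800 * expR 6 * (1 + (ln 2)^-1).
  have C10 : 0 <= C1 by rewrite mulr_ge0 // powR_ge0.
  have C20 : 0 <= C2.
    apply: mulr_ge0; last by rewrite addr_ge0 // invr_ge0 ltW.
    by apply: mulr_ge0; [exact: ler0n|exact: expR_ge0].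
  have C12 : 0 <= C1 / ln 2 by rewrite divr_ge0 // ltW.
  exists (C1 / ln 2 + C1 + C2) => V E l alpha H a1 El HA.
  have W0 := mst_weight_ge0 El.
  have [Hsp _ _ _ _] := augmented_greedy_facts a1 El HA.
  have [b1 b2] := lightness_ln_bound a1 El HA; rewrite -/C1 -/C2 in b1 b2.
  have L0 : 0 <= ln #|V|%:R :> R.
    have [->|V0] := posnP #|V|; first by rewrite ln0.
    by rewrite ln_ge0 // ler1n.
  split=> // La; apply: ler_div_of_ler_mul => //.
  - by apply: mulr_ge0 => //; rewrite !addr_ge0.
  - apply: le_trans (b1 La) _; apply: ler_wpM2r => //; apply: ler_wpM2r => //; lra.
  - by rewrite !addr_ge0.
  - by apply: le_trans (b2 La) _; apply: ler_wpM2r => //; lra.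
exists 800 => k eps V E l H k1 eps0 El HA.
have kR : 1 <= k%:R :> R by rewrite ler1n.
have a1 : 1 <= (1 + eps) * (2 * k%:R - 1).
  have : 0 <= eps * (2 * k%:R - 1) by rewrite mulr_ge0 ?(ltW eps0) //; lra.
  lra.
have [Hsp HV l0 critH [T [pos [TH wT posP]]]] := augmented_greedy_facts a1 El HA.
split=> // k2; apply: ler_div_of_ler_mul.
- have lk : 0 <= ln k%:R :> R by rewrite ln_ge0.
  apply: mulr_ge0; first exact: ler0n.
  apply: mulr_ge0; first exact: powR_ge0.
  by rewrite addr_ge0 // divr_ge0 // mulr_ge0 // powR_ge0.
- exact: mst_weight_ge0.
- by have := critical_weight HV l0 TH posP k2 eps0 (lexx _) critH; rewrite wT.
Qed.
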